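(* Let $n\ge1$, $\mathbb{F}$ a field, and $P_n\subseteq\mathbb{F}^{n\times n}$ the set of $n\times n$ permutation matrices. Then $I_n=\mathrm{gr}\,\mathbf{I}(P_n)$ as ideals of $\mathbb{F}[\mathbf{x}_{n\times n}]$. Furthermore, the set $\{\mathfrak{s}(w):w\in\mathfrak{S}_n\}$ of shadow monomials descends to a basis of $\mathbb{F}[\mathbf{x}_{n\times n}]/I_n$, and this is the standard monomial basis of $\mathbb{F}[\mathbf{x}_{n\times n}]/I_n$ with respect to the Toeplitz term order $<_{\mathrm{Top}}$.
   Context: $\mathbb{F}[\mathbf{x}_{n\times n}]$ is the polynomial ring in variables $x_{i,j}$, $1\le i,j\le n$ (the coordinate ring of $\mathbb{F}^{n\times n}$). $I_n$ is the ideal generated by all products $x_{i,j}x_{i,j'}$ and $x_{i,j}x_{i',j}$ (all indices in $[n]$, including equal ones), all row sums $\sum_j x_{i,j}$ and all column sums $\sum_i x_{i,j}$. For a finite set $Z\subseteq\mathbb{F}^{N}$, $\mathbf{I}(Z)$ is the ideal of polynomials vanishing on $Z$; for an ideal $I$, $\mathrm{gr}\,I$ is the ideal generated by the top-degree homogeneous components of all nonzero elements of $I$. The Toeplitz term order $<_{\mathrm{Top}}$ is the lexicographic order with respect to the variable order $x_{1,1}>x_{2,1}>x_{1,2}>x_{3,1}>x_{2,2}>x_{1,3}>\cdots>x_{n,n-1}>x_{n-1,n}>x_{n,n}$ (i.e. $x_{a,b}>x_{c,d}$ iff $a+b<c+d$, or $a+b=c+d$ and $a>c$). A standard monomial for $I$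 is a monomial that is not the leading monomial of any nonzero element of $I$. Shadow sets: for a finite set $X$ of lattice points with no two sharing an $x$- or $y$-coordinate, let $X_1$ be its componentwise-minimal points listed $(a_1,b_1),\dots,(a_r,b_r)$ with $a_1<\cdots<a_r$; the northeast corners of the first shadow line are $(a_{t+1},b_t)$, $1\le t<r$; remove $X_1$ and repeat. $\mathcal{S}(X)$ is the set of all such corners. For $w\in\mathfrak{S}_n$, $\mathcal{S}(w)=\mathcal{S}(\{(i,w(i))\})$ and $\mathfrak{s}(w)=\prod_{(i,j)\in\mathcal{S}(w)}x_{i,j}$. *)

(* Defs.v *)
From mathcomp Require Import all_boot all_order all_fingroup all_algebra.
From mathcomp Require Import mpoly.
Set Implicit Arguments.
Unset Strict Implicit.
Unset Printing Implicit Defensive.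
Import GRing.Theory.
Local Open Scope ring_scope.

(* Ideals are Prop-valued predicates, since over an arbitrary field membership
   in the ideals below carries no canonical boolean test. *)

Definition ideal_gen (R : comNzRingType) (G : R -> Prop) (f : R) : Prop :=
  exists s : seq (R * R),
    (forall p, p \in s -> G p.2) /\ f = \sum_(p <- s) p.1 * p.2.

(* The family of all elements of B becomes a basis of the quotient A / I:
   its elements span A modulo I, and pairwise distinct elements of B are
   linearly independent modulo I (so B embeds into the quotient). *)
Definition descends_to_basis (F : fieldType) (A : comAlgType F)
    (I B : A -> Prop) : Prop :=
  (forall f : A, exists s : seq (F * A),
     (forall p, p \in s -> B p.2) /\ I (f - \sum_(p <- s) p.1 *: p.2)) /\
  (forall (s : seq A) (c : A -> F),
     uniq s -> (forall g, g \in s -> B g) ->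
     I (\sum_(g <- s) c g *: g) -> forall g, g \in s -> c g = 0).

Section PolynomialIdeals.
Variables (F : fieldType) (N : nat).
Implicit Types (f g : {mpoly F[N]}) (m : 'X_{1..N}).
Implicit Types I : {mpoly F[N]} -> Prop.

Definition vanishing_ideal (Z : 'rV[F]_N -> Prop) f : Prop :=
  forall z, Z z -> f.@[fun k => z 0 k] = 0.

(* For nonzero f, msize f is the total degree of f plus one. *)
Definition top_component f : {mpoly F[N]} := pihomog mdeg (msize f).-1 f.

Definition gr I : {mpoly F[N]} -> Prop :=
  ideal_gen (fun g => exists f, [/\ I f, f != 0 & g = top_component f]).

(* lt is the strict part of the term order. *)
Definition is_leading_monomial (lt : rel 'X_{1..N}) f m : Prop :=
  m \in msupp f /\ forall m', m' \in msupp f -> m' != m -> lt m' m.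

Definition standard_monomial (lt : rel 'X_{1..N}) I m : Prop :=
  ~ exists f, [/\ I f, f != 0 & is_leading_monomial lt f m].

End PolynomialIdeals.

(* The variables x_{i,j} are indexed by 'I_(n * n) through mxvec_index, so that
   x_{i,j} evaluates at the flattened matrix mxvec A to the entry A i j. Indices
   start at 0, which affects none of the comparisons below. *)
Section PermutationLocus.
Variables (F : fieldType) (n : nat).

Definition xvar (i j : 'I_n) : {mpoly F[n * n]} := 'X_(mxvec_index i j).

Variant I_gen : {mpoly F[n * n]} -> Prop :=
| I_gen_row i j j' : I_gen (xvar i j * xvar i j')
| I_gen_col i i' j : I_gen (xvar i j * xvar i' j)
| I_gen_row_sum i : I_gen (\sum_j xvar i j)
| I_gen_col_sum j : I_gen (\sum_i xvar i j).

Definition I_ideal : {mpoly F[n * n]} -> Prop := ideal_gen I_gen.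

Definition perm_matrix_locus (z : 'rV[F]_(n * n)) : Prop :=
  exists2 A : 'M[F]_n, is_perm_mx A & z = mxvec A.

End PermutationLocus.

Section Toeplitz.
Variable n : nat.

Definition toeplitz_var_gt (p q : 'I_n * 'I_n) : bool :=
  (p.1 + p.2 < q.1 + q.2)%N || (p.1 + p.2 == q.1 + q.2)%N && (q.1 < p.1)%N.

Definition toeplitz_lt (m m' : 'X_{1..n * n}) : bool :=
  [exists p : 'I_n * 'I_n,
     (m (mxvec_index p.1 p.2) < m' (mxvec_index p.1 p.2))%N &&
     [forall q : 'I_n * 'I_n, toeplitz_var_gt q p ==>
        (m (mxvec_index q.1 q.2) == m' (mxvec_index q.1 q.2))]].

End Toeplitz.

Section Shadows.
Variable n : nat.
Implicit Types X : {set 'I_n * 'I_n}.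

Definition minimal_points X : {set 'I_n * 'I_n} :=
  [set p in X | [forall q in X, (q.1 <= p.1)%N && (q.2 <= p.2)%N ==> (q == p)]].

(* The minimal points (a_1,b_1), ..., (a_r,b_r) with a_1 < ... < a_r. *)
Definition shadow_line X : seq ('I_n * 'I_n) :=
  sort (fun p q : 'I_n * 'I_n => (p.1 <= q.1)%N) (enum (minimal_points X)).

(* Consecutive points (a_t,b_t), (a_{t+1},b_{t+1}) give (a_{t+1},b_t). *)
Definition northeast_corners X : {set 'I_n * 'I_n} :=
  let s := shadow_line X in
  [set:: [seq (pq.2.1, pq.1.2) | pq <- zip s (behead s)]].

(* #|X| rounds suffice: each round removes a point from a nonempty set, and the
   empty set has no corners. *)
Definition shadow_set X : {set 'I_n * 'I_n} :=
  \bigcup_(k < #|X|)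
    northeast_corners (iter k (fun Y => Y :\: minimal_points Y) X).

Definition perm_points (w : 'S_n) : {set 'I_n * 'I_n} := [set (i, w i) | i : 'I_n].

Definition shadow_monomial (F : fieldType) (w : 'S_n) : {mpoly F[n * n]} :=
  \prod_(p in shadow_set (perm_points w)) xvar F p.1 p.2.

End Shadows.

(* Main.v *)
(** Viennot's shadow lines of a permutation [w] form a growth diagram: let
    [L i j] be the number of lines below and to the left of the lattice point
    [(i, j)]. Around a cell [L] satisfies a local rule whose two exceptional
    cases are the points of [w] and the corners of the lines, that is, the
    rooks of the shadow set; exchanging these two cases and reversing the axes
    leaves the rule unchanged. Starting from a rook placement [R] one can hence
    compute [L] backwards from the outer boundary, and [R] is a shadow set as
    soon as the result vanishes on the inner boundary, which is a ballot
    condition on the chains of [R].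

    If the ballot condition fails for a chain [C] and the columns before [c],
    let [S] be the rows of [C] and [T] its columns together with those from [c]
    on. Modulo the ideal, the product over [S] of the partial row sums over [T]
    changes only by a sign when [T] is replaced by its complement, and after
    multiplication by the rooks outside [C] too few columns are left for the
    rows of [S]; the leading monomial of the resulting relation is that of [R].

    Thus the shadow monomials span the quotient by [I_n], compatibly with
    degree and term order, so they span the functions on the [n!] permutation
    matrices. As there are at most [n!] of them, they are independent there,
    hence modulo the associated graded ideal, which contains [I_n]. *)
Require Import Defs.
From mathcomp Require Import all_boot all_order all_fingroup all_algebra.
From mathcomp Require Import mpoly zify.
Set Implicit Arguments.
Unset Strict Implicit.
Unset Printing Implicit Defensive.

(** * Growth diagrams of shadow lines *)

Lemma zip_beheadP (T : eqType) (key : T -> nat) (s : seq T) (p q : T) :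
  sorted (relpre key ltn) s ->
  reflect [/\ p \in s, q \in s, key p < key q &
             forall t, t \in s -> ~~ (key p < key t < key q)]
          ((p, q) \in zip s (behead s)).
Proof.
have head_lt z s' t : sorted (relpre key ltn) (z :: s') -> t \in s' -> key z < key t.
  rewrite /= path_sortedE; last by move=> ? ? ? /=; apply: ltn_trans.
  by case/andP=> /allP h _ /h.
elim: s => [|x [|y s] IH] srt; first by apply: (iffP idP) => // -[].
  by apply: (iffP idP) => // -[]; rewrite !inE => /eqP-> /eqP->; rewrite ltnn.
have zipE : zip [:: x, y & s] (behead [:: x, y & s]) = (x, y) :: zip (y :: s) (behead (y :: s)) by [].
rewrite zipE; apply: (iffP idP).
- have /andP[xy srt'] := srt.
  have gt_x t : t \in y :: s -> key x < key t by apply: head_lt.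
  have gt_y t : t \in y :: s -> key y <= key t.
    rewrite inE => /orP[/eqP->//|ts]; apply: ltnW.
    exact: head_lt ts.
  rewrite inE => /orP[/eqP[-> ->]|/(IH srt')[ps qs pq nb]].
    split=> //; rewrite ?inE ?eqxx ?orbT // => t.
    by rewrite inE => /orP[/eqP->|/gt_y]; lia.
  split; rewrite ?[_ \in [:: x, _ & _]]inE ?ps ?qs ?orbT // => t.
  rewrite inE => /orP[/eqP->|/nb//].
  by move: (gt_x p ps); lia.
- have /andP[xy srt'] := srt.
  have gt_x t : t \in y :: s -> key x < key t by apply: head_lt.
  have gt_y t : t \in y :: s -> t != y -> key y < key t.
    rewrite inE => /orP[/eqP->|ts _]; first by rewrite eqxx.
    exact: head_lt ts.
  case=> p_in q_in pq nb.
  move: p_in q_in pq nb; rewrite inE => /orP[/eqP->|ps]; rewrite inE => /orP[/eqP qx|qs] pq nb.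
  + by move: pq; rewrite qx ltnn.
  + rewrite inE xpair_eqE eqxx /=.
    case: (eqVneq q y) => //= qy.
    have := nb y; rewrite !inE eqxx orbT (gt_y _ qs qy) andbT => /(_ isT).
    by move: xy => /= ->.
  + by move: pq (gt_x p ps); rewrite qx; lia.
  + rewrite inE; apply/orP; right; apply/IH => //; split=> // t ts.
    by apply: nb; rewrite inE ts orbT.
Qed.

(** Removes the sorted list from the description of the corners. Distinct first coordinates make the
    sorting strict, so neighbours in the list are the pairs with nothing in between. *)
Lemma northeast_cornersP n (X : {set 'I_n * 'I_n}) (p : 'I_n * 'I_n) :
  {in X &, forall u v, u.1 = v.1 -> u = v} ->
  reflect (exists u v, [/\ u \in minimal_points X, v \in minimal_points X,
             u.1 < v.1, p = (v.1, u.2) &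
             forall t, t \in minimal_points X -> ~~ (u.1 < t.1 < v.1)])
          (p \in northeast_corners X).
Proof.
move=> injX.
have mem t : (t \in shadow_line X) = (t \in minimal_points X).
  by rewrite mem_sort mem_enum.
have srt : sorted (relpre (fun u : 'I_n * 'I_n => val u.1) ltn) (shadow_line X).
  rewrite -sorted_map ltn_sorted_uniq_leq.
  apply/andP; split; last first.
    by rewrite sorted_map; apply: sort_sorted => u v; apply: leq_total.
  rewrite map_inj_in_uniq ?sort_uniq ?enum_uniq // => u v; rewrite !mem !inE.
  by case/andP=> uX _ /andP[vX _] /val_inj; apply: injX.
rewrite /northeast_corners inE; apply: (iffP mapP).
- case=> -[u v] /(zip_beheadP _ _ srt)[]; rewrite !mem => um vm uv nb ->.
  by exists u, v; split=> // t tm; apply: nb; rewrite mem.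
- case=> u [v [um vm uv -> nb]]; exists (u, v) => //.
  by apply/(zip_beheadP _ _ srt); rewrite !mem; split=> // t; rewrite mem => /nb.
Qed.

(* The local rule of a cell with lower left corner value [a], lower right [b],
   upper left [c] and upper right [d]; [r] says that the cell holds a rook. *)
Definition cell_rule (r : bool) (a b c d : nat) : Prop :=
  if r then [/\ b = a.+1, c = a.+1 & d = a.+1]
  else [/\ a = minn b c, b <= d <= b.+1 & c <= d <= c.+1].

Definition growth (n : nat) (r : nat -> nat -> bool) (L : nat -> nat -> nat) :=
  [/\ forall i, i <= n -> L i 0 = 0, forall j, j <= n -> L 0 j = 0 &
      forall i j, i < n -> j < n ->
        cell_rule (r i j) (L i j) (L i.+1 j) (L i j.+1) (L i.+1 j.+1)].

(** The second exceptional case of the local rule, dual to a rook: a cell where the count goes up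
    only at the far corner. These cells will be the points of the permutation. *)
Definition growth_point (L : nat -> nat -> nat) (i j : nat) : bool :=
  [&& L i.+1 j == L i j, L i j.+1 == L i j & L i.+1 j.+1 == (L i j).+1].

Lemma growth_tr n r L : growth n r L ->
  growth n (fun i j => r j i) (fun i j => L j i).
Proof.
case=> h1 h2 h3; split=> // i j ltin ltjn; move: (h3 j i ltjn ltin).
rewrite /cell_rule; case: (r j i) => -[a b c]; split=> //.
by rewrite minnC.
Qed.

Lemma growth_point_tr L i j :
  growth_point (fun i j => L j i) i j = growth_point L j i.
Proof. by rewrite /growth_point andbCA. Qed.

Section Growth.
Variables (n : nat) (r : nat -> nat -> bool) (L : nat -> nat -> nat).
Hypothesis gL : growth n r L.

Lemma growth_cell i j : i < n -> j < n ->
  cell_rule (r i j) (L i j) (L i.+1 j) (L i j.+1) (L i.+1 j.+1).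
Proof. by case: gL => _ _ h; apply: h. Qed.

Lemma growth_step i j : i < n -> j <= n -> L i j <= L i.+1 j <= (L i j).+1.
Proof.
move=> ltin; case: j => [_|j ltjn].
  by case: gL => h _ _; rewrite !h // ltnW.
by move: (growth_cell ltin ltjn); rewrite /cell_rule; case: (r i j) => -[]; lia.
Qed.

Lemma growth_monol i i' j : i <= i' -> i' <= n -> j <= n -> L i j <= L i' j.
Proof.
move=> + + lejn; elim: i' => [|i' IH]; first by rewrite leqn0 => /eqP->.
rewrite leq_eqVlt ltnS => /orP[/eqP->//|le] lt.
by apply: leq_trans (IH le (ltnW lt)) _; case/andP: (growth_step lt lejn).
Qed.

(** Descending between columns [i] and [i.+1], the increment persists at the same value until a
    point is met, and it must end because [L] vanishes at height 0. *)
Lemma growth_point_col i j : i < n -> j <= n -> L i.+1 j = (L i j).+1 ->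
  exists2 b, b < j & growth_point L i b /\ L i b = L i j.
Proof.
move=> ltin; elim: j => [|j IH] lejn up.
  by move: up; case: gL => h _ _; rewrite !h // ltnW.
case: (boolP (growth_point L i j)) => [w|nw].
  by exists j => //; split=> //; case/and3P: w => _ /eqP.
have [up' eqL] : L i.+1 j = (L i j).+1 /\ L i j = L i j.+1.
  move: (growth_cell ltin lejn) nw (growth_step ltin (ltnW lejn)).
  by rewrite /growth_point /cell_rule; case: (r i j) => -[]; lia.
have [b ltb [w e]] := IH (ltnW lejn) up'.
by exists b; [apply: ltnW|rewrite e].
Qed.

(** The increment between the two columns rises by one past a point, drops by one past a rook and is
    unchanged past any other cell. *)
Lemma growth_col_sum i y : i < n -> y <= n ->
  L i.+1 y + \sum_(j < y) r i j = L i y + \sum_(j < y) growth_point L i j.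
Proof.
move=> ltin; elim: y => [_|y IH lty].
  by rewrite !big_ord0; case: gL => h _ _; rewrite !h // ltnW.
rewrite !big_ord_recr /=; move: (IH (ltnW lty)) (growth_cell ltin lty).
move: (\sum_(j < y) r i j) (\sum_(j < y) growth_point L i j) => A B.
rewrite /growth_point /cell_rule; case: (r i y) => IHy -[] *.
  by case: and3P => [[/eqP ? /eqP ? /eqP ?]|_] /=; lia.
case: (boolP [&& _, _ & _]) => [/and3P[/eqP ? /eqP ? /eqP ?]|] /=; first lia.
rewrite !negb_and; lia.
Qed.

End Growth.

Lemma growth_mono n r L i j i' j' : growth n r L ->
  i <= i' -> j <= j' -> i' <= n -> j' <= n -> L i j <= L i' j'.
Proof.
move=> gL li lj li' lj'.
apply: (leq_trans (growth_monol gL li li' (leq_trans lj lj'))).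
exact: (growth_monol (growth_tr gL)).
Qed.

Lemma growth_point_row n r L i j : growth n r L ->
  i <= n -> j < n -> L i j.+1 = (L i j).+1 ->
  exists2 a, a < i & growth_point L a j /\ L a j = L i j.
Proof.
move=> gL lein ltjn /(growth_point_col (growth_tr gL) ltjn lein)[a lta [w e]].
by exists a => //; rewrite growth_point_tr in w.
Qed.

(* Walking down and left from a corner of value above [k], the walk can only
   be blocked at a point where the value drops to [k] on both sides. *)
Lemma growth_point_below n r L i j k : growth n r L ->
  i <= n -> j <= n -> k < L i j ->
  exists a b, [/\ a < i, b < j, growth_point L a b & L a b = k].
Proof.
move=> gL; move: {2}(i + j) (leqnn (i + j)) => s.
elim: s i j => [|s IH] [|i] [|j] //= les lein lejn ltk;
  try by case: gL => h1 h2 h3; rewrite ?h1 ?h2 ?h3 // in ltk.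
case: (ltnP k (L i j.+1)) => [lt1|le1].
  have [|a [b [? ? ? ?]]] := IH i j.+1 _ (ltnW lein) lejn lt1; first lia.
  by exists a, b; split=> //; apply: ltnW.
case: (ltnP k (L i.+1 j)) => [lt2|le2].
  have [|a [b [? ? ? ?]]] := IH i.+1 j _ lein (ltnW lejn) lt2; first lia.
  by exists a, b; split=> //; apply: ltnW.
exists i, j; rewrite !ltnSn; move: (growth_cell gL lein lejn).
by rewrite /growth_point /cell_rule; case: (r i j) => -[]; split=> //; lia.
Qed.

Lemma growth_le n r L i j : growth n r L -> i <= n -> j <= n -> L i j <= i.
Proof.
move=> gL + lejn; elim: i => [|i IH] lein; first by case: gL => _ ->.
by have /andP[_ h] := growth_step gL lein lejn; apply: leq_trans h _; apply: IH (ltnW lein).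
Qed.

Lemma growth_point_lt n r L i j i' j' : growth n r L ->
  growth_point L i j -> i < i' -> j < j' -> i' <= n -> j' <= n ->
  L i j < L i' j'.
Proof.
by move=> gL /and3P[_ _ /eqP<-] *; apply: growth_mono gL _ _ _ _.
Qed.

(** * Reading shadow lines off a growth diagram *)

Section GrowthShadow.
Variables (n : nat) (r : nat -> nat -> bool) (L : nat -> nat -> nat) (w : 'S_n).
Hypothesis gL : growth n r L.
Hypothesis wP : forall i j : 'I_n, growth_point L i j = (w i == j).

Let X := perm_points w.
Let lev (p : 'I_n * 'I_n) := L p.1 p.2.

Lemma mem_perm_points (p : 'I_n * 'I_n) : (p \in X) = growth_point L p.1 p.2.
Proof.
rewrite wP; apply/imsetP/eqP => [[i _ ->] //|e].
by exists p.1 => //; case: p e => /= a b ->.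
Qed.

Lemma perm_points_inj1 : {in X &, forall u v, u.1 = v.1 -> u = v}.
Proof. by move=> _ _ /imsetP[i _ ->] /imsetP[j _ ->] /= ->. Qed.

Lemma perm_points_inj2 : {in X &, forall u v, u.2 = v.2 -> u = v}.
Proof.
by move=> _ _ /imsetP[i _ ->] /imsetP[j _ ->] /= /perm_inj ->.
Qed.

Lemma lev_lt (u v : 'I_n * 'I_n) :
  u \in X -> u.1 < v.1 -> u.2 < v.2 -> lev u < lev v.
Proof.
rewrite mem_perm_points => uX l1 l2.
by apply: growth_point_lt gL uX l1 l2 _ _; apply: ltnW.
Qed.

Lemma lev_below (i j : 'I_n) k : k < L i j ->
  exists2 u, u \in X & [/\ u.1 < i, u.2 < j & lev u = k].
Proof.
case/(growth_point_below gL (ltnW (ltn_ord i)) (ltnW (ltn_ord j))).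
move=> a [b [lta ltb pt e]].
exists (Ordinal (ltn_trans lta (ltn_ord i)), Ordinal (ltn_trans ltb (ltn_ord j))) => //.
by rewrite mem_perm_points.
Qed.

(** A point of level above [k] has one of level [k] strictly below it in both coordinates, while a
    point strictly above another has larger level. Hence [lev] numbers the shadow lines from 0. *)
Lemma minimal_points_level k :
  minimal_points [set p in X | k <= lev p] = [set p in X | lev p == k].
Proof.
apply/setP=> p; rewrite !inE; case: (boolP (p \in X)) => //= pX.
apply/andP/eqP => [[]|e].
- rewrite leq_eqVlt => /orP[/eqP->//|ltk] /forall_inP nq.
  have [u uX [l1 l2 e]] := lev_below ltk.
  have := nq u; rewrite inE uX e leqnn (ltnW l1) (ltnW l2) => /(_ isT) /eqP eu.
  by move: l1; rewrite eu ltnn.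
- rewrite e; split=> //; apply/forall_inP => q; rewrite inE => /andP[qX leq].
  apply/implyP => /andP[l1 l2]; case: (ltngtP q.1 p.1) l1 => // [l1|e1] _; last first.
    by apply/eqP/perm_points_inj1 => //; apply: val_inj.
  case: (ltngtP q.2 p.2) l2 => // [l2|e2] _; last first.
    by apply/eqP/perm_points_inj2 => //; apply: val_inj.
  by have := lev_lt qX l1 l2; rewrite e ltnNge leq.
Qed.

Lemma iter_shadow_level k :
  iter k (fun Y => Y :\: minimal_points Y) X = [set p in X | k <= lev p].
Proof.
elim: k => [|k IH]; first by apply/setP=> p; rewrite inE andbT.
rewrite iterS IH minimal_points_level; apply/setP=> p; rewrite !inE.
by case: (p \in X); rewrite ?andbF //= ltn_neqAle eq_sym.
Qed.

Lemma growth_shadow : shadow_set X = [set p : 'I_n * 'I_n | r p.1 p.2].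
Proof.
have inj1 k : {in [set p in X | k <= lev p] &, forall u v, u.1 = v.1 -> u = v}.
  move=> u v; rewrite !inE => /andP[uX _] /andP[vX _]; exact: perm_points_inj1.
have min_mem k t : (t \in minimal_points [set p in X | k <= lev p]) =
    (t \in X) && (lev t == k) by rewrite minimal_points_level inE.
apply/setP=> p; rewrite inE; apply/bigcupP/idP => [[k _]|rp].
- rewrite iter_shadow_level => /(northeast_cornersP _ (inj1 k)) [u [v []]].
  rewrite !min_mem => /andP[uX /eqP eu] /andP[vX /eqP ev] ltuv -> {p} /= nb.
  have lt2 : v.2 < u.2.
    case: (ltngtP v.2 u.2) => // [lt2|e2].
      by have := lev_lt uX ltuv lt2; rewrite eu ev ltnn.
    have e : u = v by apply: perm_points_inj2 => //; apply: val_inj.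
    by move: ltuv; rewrite e ltnn.
  (* A larger value would give a point of level [k] strictly below and left of this corner: it would
     lie between [u] and [v], be [u] itself or be strictly below [u], all impossible. *)
  have eL : L v.1 u.2 = k.
    apply/eqP; rewrite eqn_leq -{2}ev (growth_mono gL) // ?(ltnW lt2) ?(ltnW (ltn_ord _)) //.
    rewrite andbT leqNgt; apply/negP => /lev_below [t tX [l1 l2 et]].
    have := nb t; rewrite min_mem tX et eqxx l1 => /(_ isT).
    rewrite andbT -leqNgt leq_eqVlt => /orP[/eqP e|l3].
      have e' : t = u by apply: perm_points_inj1 => //; apply: val_inj.
      by move: l2; rewrite e' ltnn.
    by have := lev_lt tX l3 l2; rewrite et eu ltnn.
  move: uX vX; rewrite !mem_perm_points => uX vX.
  (* Two neighbouring corners of the cell exceed [k], so the minimum in the regular case of the rule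
     fails and the cell holds a rook. *)
  have h1 : k < L v.1.+1 u.2.
    by rewrite -[in X in X < _]ev; apply: growth_point_lt gL vX _ _ _ _ => //; apply: ltnW.
  have h2 : k < L v.1 u.2.+1.
    by rewrite -[in X in X < _]eu; apply: growth_point_lt gL uX _ _ _ _ => //; apply: ltnW.
  have := growth_cell gL (ltn_ord v.1) (ltn_ord u.2); rewrite /cell_rule.
  by case: (r _ _) => // -[]; lia.
- case: p rp => i j /= rij.
  have := growth_cell gL (ltn_ord i) (ltn_ord j); rewrite /cell_rule rij => -[e1 e2 e3].
  (* The walks down and left from the rook end at the two neighbours [(i, b)] and [(a, j)] on the
     line of level [L i j]. *)
  have [b ltb [wb eb]] := growth_point_col gL (ltn_ord i) (ltnW (ltn_ord j)) e1.
  have [a lta [wa ea]] := growth_point_row gL (ltnW (ltn_ord i)) (ltn_ord j) e2.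
  have ltk : L i j < #|X|.
    rewrite card_imset; last by move=> ? ? [].
    by rewrite card_ord; apply: leq_ltn_trans (growth_le gL _ _) (ltn_ord i); apply: ltnW.
  exists (Ordinal ltk) => //=; rewrite iter_shadow_level.
  apply/(northeast_cornersP _ (inj1 _)).
  exists (Ordinal (ltn_trans lta (ltn_ord i)), j).
  exists (i, Ordinal (ltn_trans ltb (ltn_ord j))).
  rewrite !min_mem !mem_perm_points /lev /= ea eb wa wb eqxx; split=> // t.
  rewrite min_mem => /andP[tX /eqP et]; apply/negP => /andP[l1 l2].
  have := lev_lt (u := (Ordinal (ltn_trans lta (ltn_ord i)), j)) (v := t).
  rewrite mem_perm_points wa l1 et /lev /= ea ltnn => nlt.
  suff lt2 : t.2 < j by have := lev_lt (v := (i, j)) tX l2 lt2; rewrite et /lev /= ltnn.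
  case: (ltngtP j t.2) => // [lt|e]; first by have := nlt isT isT lt.
  have e' : t = (Ordinal (ltn_trans lta (ltn_ord i)), j).
    by apply: (perm_points_inj2 tX); [rewrite mem_perm_points | apply/val_inj].
  by move: l1; rewrite e' ltnn.
Qed.

End GrowthShadow.

(** * Rook placements satisfying the ballot condition *)

Section RookPlacements.
Variable n : nat.
Implicit Types R C : {set 'I_n * 'I_n}.

Definition rook_placement R :=
  {in R &, injective (fun p => p.1)} /\ {in R &, injective (fun p => p.2)}.

Definition chain C := {in C &, forall u v : 'I_n * 'I_n, u.1 < v.1 -> u.2 < v.2}.

Definition below (f : 'I_n * 'I_n -> 'I_n) R c := [set p in R | f p < c].

(* By Greene's theorem this is the ballot condition comparing, for every [c],
   the first row of the insertion tableau of the rooks in the first [c] lines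
   with the empty ones among these lines. *)
Definition ballot R := forall C c, C \subset R -> chain C -> c <= n ->
  (below fst C c = C -> #|C| + #|below fst R c| <= c) /\
  (below snd C c = C -> #|C| + #|below snd R c| <= c).

Definition vacant (f : 'I_n * 'I_n -> 'I_n) R k :=
  [forall p in R, val (f p) != k].

Lemma vacantPn f R k :
  reflect (exists2 p, p \in R & val (f p) = k) (~~ vacant f R k).
Proof.
rewrite /vacant negb_forall_in; apply: (iffP exists_inP) => -[p pR].
  by rewrite negbK => /eqP; exists p.
by move=> <-; exists p; rewrite // negbK.
Qed.

Lemma sum_vacant f R c : {in R &, injective f} -> c <= n ->
  \sum_(0 <= k < c) vacant f R k + #|below f R c| = c.
Proof.
move=> injf; elim: c => [_|c IH ltc].
  rewrite big_geq // add0n; apply/eqP; rewrite cards_eq0; apply/eqP/setP=> p.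
  by rewrite !inE ltn0 andbF.
rewrite big_nat_recr //=; case: (boolP (vacant f R c)) => [/forall_inP vac|].
  have -> : below f R c.+1 = below f R c.
    apply/setP=> p; rewrite !inE ltnS leq_eqVlt.
    by case: (boolP (p \in R)) => //= /vac /negbTE ->.
  by rewrite addn1 addSn IH // ltnW.
case/vacantPn=> p pR fp; rewrite addn0.
have -> : below f R c.+1 = p |: below f R c.
  apply/setP=> q; rewrite !inE ltnS leq_eqVlt.
  case: (eqVneq q p) => [->|nqp]; first by rewrite pR fp eqxx.
  case: (boolP (q \in R)) => //= qR; case: eqP => // e; case/eqP: nqp.
  by apply: injf => //; apply: val_inj; rewrite /= e fp.
by rewrite cardsU1 !inE fp ltnn andbF /= add1n addnS IH // ltnW.
Qed.

End RookPlacements.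

(** * Backward computation from the outer boundary *)

Section Depth.
Variables (n : nat) (R : {set 'I_n * 'I_n}).
Hypothesis rookR : rook_placement R.

Definition rook_at (i j : nat) : bool :=
  [exists p in R, (val p.1 == i) && (val p.2 == j)].

Lemma rook_atP i j :
  reflect (exists2 p, p \in R & val p.1 = i /\ val p.2 = j) (rook_at i j).
Proof.
apply: (iffP exists_inP) => -[p pR]; first by case/andP=> /eqP ? /eqP ?; exists p.
by case=> <- <-; exists p; rewrite ?eqxx.
Qed.

Lemma rook_at_row i j j' : rook_at i j -> rook_at i j' -> j = j'.
Proof.
case/rook_atP=> p pR [e1 e2] /rook_atP[q qR [e1' e2']].
have e : p = q by apply: (proj1 rookR) => //; apply: val_inj; rewrite /= e1 e1'.
by rewrite -e2 -e2' e.
Qed.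

Lemma rook_at_col i i' j : rook_at i j -> rook_at i' j -> i = i'.
Proof.
case/rook_atP=> p pR [e1 e2] /rook_atP[q qR [e1' e2']].
have e : p = q by apply: (proj2 rookR) => //; apply: val_inj; rewrite /= e2 e2'.
by rewrite -e1 -e1' e.
Qed.

Lemma rook_at_vacant1 i j : rook_at i j -> vacant fst R i = false.
Proof.
case/rook_atP=> p pR [e _]; apply/negbTE/vacantPn; by exists p.
Qed.

Lemma rook_at_vacant2 i j : rook_at i j -> vacant snd R j = false.
Proof.
case/rook_atP=> p pR [_ e]; apply/negbTE/vacantPn; by exists p.
Qed.

Definition vacancies f c := \sum_(c <= k < n) vacant f R k.

Lemma vacancies_rec f c : c < n -> vacancies f c = vacant f R c + vacancies f c.+1.
Proof. by move=> ltc; rewrite /vacancies big_ltn. Qed.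

(** The arguments are the distances to the outer boundary, where the computation starts; the inner
    [fix] recurses on the second distance for a fixed first one. *)
Fixpoint depth_rec a : nat -> nat :=
  if a is a'.+1 then
    fix rec b := if b is b'.+1
      then maxn (depth_rec a' b) (rec b') + rook_at (n - a) (n - b)
      else vacancies fst (n - a)
  else fun b => vacancies snd (n - b).

(* The number of shadow lines that still have to be met when going from [(i, j)]
   to the outer corner; a line leaves the grid through a vacant row or column. *)
Definition depth i j := depth_rec (n - i) (n - j).

Lemma depth_top i : i <= n -> depth i n = vacancies fst i.
Proof.
move=> lein; rewrite /depth subnn.
case e: (n - i) => [|a] /=; last by rewrite -e subKn.
have -> : i = n by lia.
by rewrite subn0 /vacancies !big_geq.
Qed.

Lemma depth_right j : j <= n -> depth n j = vacancies snd j.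
Proof. by move=> lejn; rewrite /depth subnn /= subKn. Qed.

Lemma depthE i j : i < n -> j < n ->
  depth i j = maxn (depth i.+1 j) (depth i j.+1) + rook_at i j.
Proof.
move=> lti ltj; rewrite /depth -[n - i]prednK ?subn_gt0 //.
rewrite -[n - j]prednK ?subn_gt0 // -!subnS /= -?[(n - _).+1]subSn // !subSS.
by rewrite !subKn // ltnW.
Qed.

Lemma depth_ind (P : nat -> nat -> Prop) :
  (forall i j, i <= n -> j <= n ->
     (i < n -> P i.+1 j) -> (j < n -> P i j.+1) -> P i j) ->
  forall i j, i <= n -> j <= n -> P i j.
Proof.
move=> step i j; move: {2}(n - i + (n - j)) (leqnn (n - i + (n - j))) => s.
elim: s i j => [|s IH] i j les lei lej; apply: step => // lt; try lia;
  by apply: IH => //; lia.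
Qed.

Lemma depth_le i j : i <= n -> j <= n ->
  (i < n -> depth i.+1 j <= depth i j) /\ (j < n -> depth i j.+1 <= depth i j).
Proof.
rewrite leq_eqVlt => /orP[/eqP-> lej|lti].
  split=> [|ltj]; first by rewrite ltnn.
  by rewrite !depth_right ?(ltnW ltj) // (vacancies_rec _ ltj) leq_addl.
rewrite leq_eqVlt => /orP[/eqP->|ltj].
  split=> [_|]; last by rewrite ltnn.
  by rewrite !depth_top ?(ltnW lti) // (vacancies_rec _ lti) leq_addl.
by split=> _; rewrite (depthE lti ltj); lia.
Qed.

(** An increment across a line stems from a vacancy at its outer end or, further inwards, from a
    rook. Beyond a rook there is thus none, as its line is neither vacant nor holds a second rook.
    The bound by one at a rook uses this absence, so both are proved together. *)
Lemma depth_step i j : i <= n -> j <= n ->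
  (i < n -> depth i j <= (depth i.+1 j).+1 /\
     forall y, y < j -> rook_at i y -> depth i j <= depth i.+1 j) /\
  (j < n -> depth i j <= (depth i j.+1).+1 /\
     forall x, x < i -> rook_at x j -> depth i j <= depth i j.+1).
Proof.
move: i j; apply: depth_ind => i j lei lej IHi IHj.
case: (ltngtP i n) lei => // [lti|->] _; last first.
  split=> // ltj; rewrite !depth_right ?(ltnW ltj) // (vacancies_rec _ ltj).
  split=> [|x _ /rook_at_vacant2->//]; by case: (vacant _ _ _).
case: (ltngtP j n) lej => // [ltj|->] _; last first.
  split=> // _; rewrite !depth_top ?(ltnW lti) // (vacancies_rec _ lti).
  split=> [|y _ /rook_at_vacant1->//]; by case: (vacant _ _ _).
have [_ /(_ ltj) [Hi Hi']] := IHi lti; have [/(_ lti) [Hj Hj'] _] := IHj ltj.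
have [_ /(_ ltj) Mi] := depth_le (i := i.+1) (j := j) lti (ltnW ltj).
have [/(_ lti) Mj _] := depth_le (i := i) (j := j.+1) (ltnW lti) ltj.
rewrite (depthE lti ltj); case: (boolP (rook_at i j)) => [rij|_] /=.
  have h1 := Hi' i (ltnSn i) rij; have h2 := Hj' j (ltnSn j) rij.
  split=> _; split; try lia; move=> y lty ry.
    by move: (rook_at_row rij ry); lia.
  by move: (rook_at_col rij ry); lia.
split=> _; split; try lia; move=> y lty ry.
  by have := Hj' y (ltnW lty) ry; lia.
by have := Hi' y (ltnW lty) ry; lia.
Qed.

Lemma depth_rook i j : i < n -> j < n -> rook_at i j ->
  depth i.+1 j = depth i.+1 j.+1 /\ depth i j.+1 = depth i.+1 j.+1.
Proof.
move=> lti ltj rij.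
have [_ /(_ ltj) [_ /(_ i (ltnSn i) rij) h1]] := depth_step (i := i.+1) lti (ltnW ltj).
have [/(_ lti) [_ /(_ j (ltnSn j) rij) h2] _] := depth_step (j := j.+1) (ltnW lti) ltj.
have [_ /(_ ltj) h3] := depth_le (i := i.+1) (j := j) lti (ltnW ltj).
have [/(_ lti) h4 _] := depth_le (i := i) (j := j.+1) (ltnW lti) ltj.
by split; lia.
Qed.

Definition inside i j (C : {set 'I_n * 'I_n}) :=
  forall p, p \in C -> (i <= p.1) && (j <= p.2).

(** A chain followed by an exit from the grid: the rooks of [C] all come before [c], and the
    vacancies from [c] on are added. *)
Definition depth_witness i j v (C : {set 'I_n * 'I_n}) :=
  (exists c, [/\ i <= c <= n, below fst C c = C & v <= #|C| + vacancies fst c]) \/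
  (exists c, [/\ j <= c <= n, below snd C c = C & v <= #|C| + vacancies snd c]).

Lemma below_addP f (C : {set 'I_n * 'I_n}) (p : 'I_n * 'I_n) c d :
  below f C c = C -> c <= d -> f p < d -> below f (p |: C) d = p |: C.
Proof.
move=> eC lecd ltp; apply/setP=> q; rewrite !inE.
case: (eqVneq q p) => [->|_] //=.
case: (boolP (q \in C)) => //=; rewrite -{1}eC inE => /andP[_ lt].
by rewrite (leq_trans lt).
Qed.

Lemma depth_witness_add (p : 'I_n * 'I_n) v (C : {set 'I_n * 'I_n}) :
  p \in R -> inside p.1.+1 p.2.+1 C -> depth_witness p.1 p.2 v C ->
  depth_witness p.1 p.2 v.+1 (p |: C).
Proof.
move=> pR ins.
have pC : p \notin C by apply/negP => /ins; rewrite ltnn.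
have rp : rook_at p.1 p.2 by apply/rook_atP; exists p.
have keep f (k : 'I_n) c : f p = k -> vacant f R k = false ->
    k <= c <= n -> below f C c = C -> v <= #|C| + vacancies f c ->
    exists c, [/\ k <= c <= n, below f (p |: C) c = p |: C &
                  v.+1 <= #|p |: C| + vacancies f c].
  move=> fp vac /andP[lekc lecn] eC le; rewrite cardsU1 pC add1n.
  case: (ltngtP k c) lekc => // [ltkc|ekc] _.
    exists c; rewrite (ltnW ltkc) lecn (below_addP eC) ?fp //; split=> //; lia.
  (* Moving the bound past line [k] loses no vacancy, since the rook [p] occupies it. *)
  exists k.+1; rewrite ltn_ord leqnSn (below_addP eC) ?fp ?ekc //; split=> //.
  by move: le; rewrite -ekc (vacancies_rec _ (ltn_ord k)) vac add0n addSn.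
case=> [[c [le eC lev]]|[c [le eC lev]]]; [left|right].
  exact: (keep fst p.1 c) (rook_at_vacant1 rp) le eC lev.
exact: (keep snd p.2 c) (rook_at_vacant2 rp) le eC lev.
Qed.

(** [depth] is a last-passage value: following the larger argument of each [maxn] outwards collects
    the rooks met on the way into a chain, up to an exit through the boundary. *)
Lemma depth_chain i j : i <= n -> j <= n ->
  exists C : {set 'I_n * 'I_n}, [/\ C \subset R, chain C, inside i j C & depth_witness i j (depth i j) C].
Proof.
move: i j; apply: depth_ind => i j lei lej IHi IHj.
case: (ltngtP i n) lei => // [lti|->] _; last first.
  exists set0; split; rewrite ?sub0set //; try by move=> ?; rewrite inE.
  right; exists j; rewrite leqnn lej cards0 depth_right //; split=> //.
  by apply/setP=> p; rewrite !inE.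
case: (ltngtP j n) lej => // [ltj|->] _; last first.
  exists set0; split; rewrite ?sub0set //; try by move=> ?; rewrite inE.
  left; exists i; rewrite leqnn (ltnW lti) cards0 depth_top ?(ltnW lti) //; split=> //.
  by apply/setP=> p; rewrite !inE.
have [C [CR chC insC wC]] : exists C : {set 'I_n * 'I_n}, [/\ C \subset R, chain C,
    inside i.+1 j C \/ inside i j.+1 C &
    depth_witness i j (maxn (depth i.+1 j) (depth i j.+1)) C].
  case: (leqP (depth i.+1 j) (depth i j.+1)) => [_|_].
    have [C [CR chC insC wC]] := IHj ltj; exists C; split=> //; first by right.
    case: wC => [[c [/andP[l1 l2] e h]]|[c [/andP[l1 l2] e h]]]; [left|right];
      by exists c; split=> //; lia.
  have [C [CR chC insC wC]] := IHi lti; exists C; split=> //; first by left.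
  case: wC => [[c [/andP[l1 l2] e h]]|[c [/andP[l1 l2] e h]]]; [left|right];
    by exists c; split=> //; lia.
rewrite depthE //; case: (boolP (rook_at i j)) => [rij|_]; last first.
  exists C; rewrite addn0; split=> //.
  by move=> p pC; case: insC => /(_ p pC); lia.
have [p pR [ep1 ep2]] := rook_atP _ _ rij.
(* The chain lies beyond the cell in one coordinate; no other rook shares a line with this one, so
   it lies beyond in both. *)
have insC' : inside i.+1 j.+1 C.
  move=> q qC; have qR := subsetP CR q qC.
  have rq : rook_at q.1 q.2 by apply/rook_atP; exists q.
  have nq1 : val q.1 = i -> val q.2 = j by move=> e; apply: (rook_at_row (i := i)); rewrite // -e.
  have nq2 : val q.2 = j -> val q.1 = i by move=> e; apply: (rook_at_col (j := j)); rewrite // -e.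
  by case: insC => /(_ q qC); move: nq1 nq2 => /=; lia.
exists (p |: C); rewrite addn1 -ep1 -ep2; split.
- by rewrite subUset sub1set pR.
- move=> u v; rewrite !inE => /orP[/eqP->|uC] /orP[/eqP->|vC]; rewrite ?ltnn //.
  + by move=> _; move: (insC' _ vC); rewrite -ep2 /=; lia.
  + by move: (insC' _ uC); rewrite -ep1 /=; lia.
  + exact: chC.
- move=> q; rewrite !inE => /orP[/eqP->|/insC']; rewrite ?leqnn // -ep1 -ep2 /=; lia.
- move: insC' wC; rewrite -ep1 -ep2; exact: depth_witness_add.
Qed.

End Depth.

(** * From the ballot condition to a permutation *)

Section BallotShadow.
Variables (n : nat) (R : {set 'I_n * 'I_n}).
Hypotheses (rookR : rook_placement R) (ballotR : ballot R).

Local Notation r := (rook_at R).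
Let m := vacancies R fst 0.

Lemma below_full f : below f R n = R.
Proof. by apply/setP=> p; rewrite inE ltn_ord andbT. Qed.

(** Both sides equal [n - #|R|]. *)
Lemma vacancies_snd0 : vacancies R snd 0 = m.
Proof.
have h1 := sum_vacant (f := fst) (proj1 rookR) (leqnn n).
have h2 := sum_vacant (f := snd) (proj2 rookR) (leqnn n).
by apply: (@addIn #|R|); move: h1 h2; rewrite !below_full => -> ->.
Qed.

(** The ballot condition says that [#|C|] is at most the number of vacancies before [c]; adding
    those from [c] on gives at most [m]. *)
Lemma depth00 : depth R 0 0 <= m.
Proof.
have [C [CR chC _]] := depth_chain rookR (leq0n n) (leq0n n).
case=> -[c [/andP[_ lecn] eC]] /leq_trans; apply.
  have [/(_ eC) h _] := ballotR CR chC lecn.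
  have := sum_vacant (f := fst) (proj1 rookR) lecn.
  rewrite /m /vacancies (@big_cat_nat _ _ _ c 0 n) //=.
  by move=> e; rewrite leq_add2r -(leq_add2r #|below fst R c|) e.
have [_ /(_ eC) h] := ballotR CR chC lecn.
have := sum_vacant (f := snd) (proj2 rookR) lecn.
rewrite -vacancies_snd0 /vacancies (@big_cat_nat _ _ _ c 0 n) //=.
by move=> e; rewrite leq_add2r -(leq_add2r #|below snd R c|) e.
Qed.

Lemma depth_anti_col i j k : i <= j -> j <= n -> k <= n -> depth R j k <= depth R i k.
Proof.
move=> + + lekn; elim: j => [|j IH]; first by rewrite leqn0 => /eqP->.
rewrite leq_eqVlt ltnS => /orP[/eqP->//|le] lt.
have [/(_ lt) h _] := depth_le R (ltnW lt) lekn.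
exact: leq_trans h (IH le (ltnW lt)).
Qed.

Lemma depth_anti_row i j k : i <= j -> j <= n -> k <= n -> depth R k j <= depth R k i.
Proof.
move=> + + lekn; elim: j => [|j IH]; first by rewrite leqn0 => /eqP->.
rewrite leq_eqVlt ltnS => /orP[/eqP->//|le] lt.
have [_ /(_ lt) h] := depth_le R lekn (ltnW lt).
exact: leq_trans h (IH le (ltnW lt)).
Qed.

Lemma depth_max i j : i <= n -> j <= n -> depth R i j <= m.
Proof.
move=> lei lej; apply: leq_trans depth00.
exact: leq_trans (depth_anti_row (leq0n j) lej lei) (depth_anti_col (leq0n i) lei _).
Qed.

Definition level i j := m - depth R i j.

(** Complementing turns the maximum of the backward recursion into the minimum of the local rule. On
    the inner boundary [depth] is at least its value [m] at a corner of the grid, which forces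
    [level] to vanish there. *)
Lemma level_growth : growth n r level.
Proof.
split=> [i lei|j lej|i j lti ltj].
- apply/eqP; rewrite subn_eq0 -vacancies_snd0 -depth_right //.
  exact: depth_anti_col.
- apply/eqP; rewrite subn_eq0 /m -depth_top //.
  exact: depth_anti_row.
have h1 := depth_max (ltnW lti) (ltnW ltj).
have h2 := depthE R lti ltj.
have [/(_ lti) [s1 _] /(_ ltj) [s2 _]] := depth_step rookR (ltnW lti) (ltnW ltj).
have [_ /(_ ltj) [s3 _]] := depth_step rookR (i := i.+1) lti (ltnW ltj).
have [/(_ lti) [s4 _] _] := depth_step rookR (j := j.+1) (ltnW lti) ltj.
have [_ /(_ ltj) l3] := depth_le R (i := i.+1) lti (ltnW ltj).
have [/(_ lti) l4 _] := depth_le R (j := j.+1) (ltnW lti) ltj.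
rewrite /level /cell_rule; case: (boolP (r i j)) h2 => [rij|_] /= h2; last by split; lia.
by have [e1 e2] := depth_rook rookR lti ltj rij; split; lia.
Qed.

Lemma sum_rook_row (i : 'I_n) : \sum_(j < n) r i j = ~~ vacant fst R i.
Proof.
case: (boolP (vacant fst R i)) => [vac|/vacantPn[p pR e]].
  apply: big1 => j _; apply/eqP; rewrite eqb0; apply/negP => /rook_at_vacant1.
  by rewrite vac.
have rp : r i p.2 by apply/rook_atP; exists p.
rewrite (bigD1 p.2) //= rp big1 // => j nj; apply/eqP; rewrite eqb0.
by apply: contra nj => rj; apply/eqP/val_inj/(rook_at_row rookR rj rp).
Qed.

Lemma sum_rook_col (j : 'I_n) : \sum_(i < n) r i j = ~~ vacant snd R j.
Proof.
case: (boolP (vacant snd R j)) => [vac|/vacantPn[p pR e]].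
  apply: big1 => i _; apply/eqP; rewrite eqb0; apply/negP => /rook_at_vacant2.
  by rewrite vac.
have rp : r p.1 j by apply/rook_atP; exists p.
rewrite (bigD1 p.1) //= rp big1 // => i ni; apply/eqP; rewrite eqb0.
by apply: contra ni => rj; apply/eqP/val_inj/(rook_at_col rookR rj rp).
Qed.

(** By [growth_col_sum] the points number the rooks plus the increment on the outer boundary: a
    vacant line has increment one and no rook, any other has increment zero and one rook. *)
Lemma level_points_row (i : 'I_n) : \sum_(j < n) growth_point level i j = 1.
Proof.
have := growth_col_sum level_growth (ltn_ord i) (leqnn n).
rewrite sum_rook_row; have lti := ltn_ord i.
rewrite /level !depth_top ?(ltnW lti) // (vacancies_rec _ _ lti).
have : vacancies R fst i <= m.
  by rewrite -depth_top ?(ltnW lti) // depth_max // ltnW.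
rewrite (vacancies_rec _ _ lti); move: (\sum_(j < n) _) => s.
by case: (vacant _ _ _) => /=; lia.
Qed.

Lemma level_points_col (j : 'I_n) : \sum_(i < n) growth_point level i j = 1.
Proof.
have := growth_col_sum (growth_tr level_growth) (ltn_ord j) (leqnn n).
rewrite sum_rook_col; have lti := ltn_ord j.
under [X in _ = _ + X]eq_bigr do rewrite growth_point_tr.
rewrite /level !depth_right ?(ltnW lti) // (vacancies_rec _ _ lti).
have : vacancies R snd j <= m.
  by rewrite -depth_right ?(ltnW lti) // depth_max // ltnW.
rewrite (vacancies_rec _ _ lti); move: (\sum_(i < n) _) => s.
by case: (vacant _ _ _) => /=; lia.
Qed.

Lemma sum_bool_eq1 (T : finType) (P : pred T) :
  \sum_(x : T) P x = 1 -> exists x0, forall x, P x = (x0 == x).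
Proof.
rewrite -big_mkcond sum1_card => /mem_card1[x0 e]; exists x0 => x.
by have := e x; rewrite !inE eq_sym.
Qed.

Lemma ballot_shadow : exists w : 'S_n, shadow_set (perm_points w) = R.
Proof.
have row (i : 'I_n) : exists j0 : 'I_n, [forall j : 'I_n, growth_point level i j == (j0 == j)].
  have [j0 e] := sum_bool_eq1 (level_points_row i).
  by exists j0; apply/forallP => j; rewrite e.
pose w0 i := xchoose (row i).
have w0P (i j : 'I_n) : growth_point level i j = (w0 i == j).
  by apply/eqP; move: j; apply/forallP; apply: (xchooseP (row i)).
have inj : injective w0.
  move=> i i' e; have [i0 ei0] := sum_bool_eq1 (level_points_col (w0 i)).
  have /eqP<- : i0 == i by rewrite -ei0 w0P.
  by apply/eqP; rewrite -ei0 w0P e.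
exists (perm inj); rewrite (growth_shadow level_growth) => [|i j]; last by rewrite permE.
apply/setP=> p; rewrite inE; apply/rook_atP/idP => [[q qR [e1 e2]]|pR].
  suff -> : p = q by [].
  by case: p q e1 e2 {qR} => [a b] [c d] /= /val_inj-> /val_inj->.
by exists p.
Qed.

End BallotShadow.

(** * Leading monomials of the ideal *)

Import GRing.Theory.
Local Open Scope ring_scope.

Section IdealGen.
Variables (R : comNzRingType) (G : R -> Prop).
Local Notation I := (ideal_gen G).

Lemma ideal_gen_mem g : G g -> I g.
Proof.
move=> Gg; exists [:: (1, g)]; rewrite big_seq1 mul1r; split=> // p.
by rewrite inE => /eqP->.
Qed.

Lemma ideal_gen0 : I 0.
Proof. by exists [::]; rewrite big_nil. Qed.

Lemma ideal_genD f g : I f -> I g -> I (f + g).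
Proof.
move=> [s [Gs ->]] [t [Gt ->]]; exists (s ++ t); rewrite big_cat; split=> // p.
by rewrite mem_cat => /orP[/Gs|/Gt].
Qed.

Lemma ideal_genM a f : I f -> I (a * f).
Proof.
move=> [s [Gs ->]]; exists [seq (a * p.1, p.2) | p <- s].
rewrite big_map big_distrr; split=> [p /mapP[q qs ->]|]; first exact: (Gs q qs).
by apply: eq_bigr => p _ /=; rewrite mulrA.
Qed.

Lemma ideal_genMr a f : I f -> I (f * a).
Proof. by rewrite mulrC; apply: ideal_genM. Qed.

Lemma ideal_genN f : I f -> I (- f).
Proof. by rewrite -mulN1r; apply: ideal_genM. Qed.

Lemma ideal_genB f g : I f -> I g -> I (f - g).
Proof. by move=> If Ig; apply: ideal_genD => //; apply: ideal_genN. Qed.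

Lemma ideal_gen_sum (T : Type) (s : seq T) (P : pred T) (E : T -> R) :
  (forall x, P x -> I (E x)) -> I (\sum_(x <- s | P x) E x).
Proof. by move=> IE; apply: big_ind => //; [apply: ideal_gen0|apply: ideal_genD]. Qed.

Lemma ideal_gen_prod (T : finType) (P : pred T) (a b : T -> R) :
  (forall x, P x -> I (a x - b x)) ->
  I (\prod_(x | P x) a x - \prod_(x | P x) b x).
Proof.
move=> Iab; apply: (big_rec2 (fun u v => I (u - v))).
  by rewrite subrr; apply: ideal_gen0.
move=> x u v Px Iuv.
have -> : a x * u - b x * v = u * (a x - b x) + b x * (u - v).
  by rewrite !mulrBr [u * a x]mulrC [u * b x]mulrC addrA subrK.
by apply: ideal_genD; apply: ideal_genM => //; apply: Iab.
Qed.

End IdealGen.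

Lemma ideal_gen_sub (R : comNzRingType) (G G' : R -> Prop) f :
  (forall g, G g -> ideal_gen G' g) -> ideal_gen G f -> ideal_gen G' f.
Proof.
move=> sub [s [Gs ->]]; rewrite big_seq; apply: ideal_gen_sum => p ps.
by apply: ideal_genM; apply: sub; apply: Gs.
Qed.

(** * The Toeplitz order and rook monomials *)

Section ToeplitzOrder.
Variable n : nat.
Implicit Types m : 'X_{1..n * n}.

Lemma toeplitz_ltP m m' :
  reflect (exists2 p : 'I_n * 'I_n,
             (m (mxvec_index p.1 p.2) < m' (mxvec_index p.1 p.2))%N &
             forall q, toeplitz_var_gt q p ->
               m (mxvec_index q.1 q.2) = m' (mxvec_index q.1 q.2))
          (toeplitz_lt m m').
Proof.
apply: (iffP existsP) => [[p /andP[lt /forallP h]]|[p lt h]]; exists p => //.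
  by move=> q gt; apply/eqP; apply: (implyP (h q)).
by rewrite lt; apply/forallP => q; apply/implyP => /h ->.
Qed.

Lemma toeplitz_ltxx m : toeplitz_lt m m = false.
Proof. by apply/negbTE/negP => /toeplitz_ltP [p]; rewrite ltnn. Qed.

Lemma toeplitz_lt_trans m1 m2 m3 :
  toeplitz_lt m1 m2 -> toeplitz_lt m2 m3 -> toeplitz_lt m1 m3.
Proof.
move=> /toeplitz_ltP[p lt1 h1] /toeplitz_ltP[q lt2 h2]; apply/toeplitz_ltP.
have trans u v t : toeplitz_var_gt (n := n) u v -> toeplitz_var_gt v t -> toeplitz_var_gt u t.
  by rewrite /toeplitz_var_gt; lia.
case: (boolP (toeplitz_var_gt p q)) => [pq|npq].
  exists p; first by rewrite -(h2 p pq).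
  by move=> u up; rewrite h1 // h2 // (trans _ _ _ up pq).
case: (boolP (toeplitz_var_gt q p)) => [qp|nqp].
  exists q; first by rewrite (h1 q qp).
  by move=> u uq; rewrite h1 ?h2 // (trans _ _ _ uq qp).
have epq : p = q.
  case: p q npq nqp {lt1 h1 lt2 h2} => [a b] [c d]; rewrite /toeplitz_var_gt /= => h h'.
  by congr pair; apply: val_inj => /=; lia.
by rewrite -epq in lt2 h2; exists p; [apply: ltn_trans lt2|move=> u up; rewrite h1 ?h2].
Qed.

Lemma toeplitz_lt_add m m1 m2 : toeplitz_lt m1 m2 -> toeplitz_lt (m + m1) (m + m2).
Proof.
case/toeplitz_ltP=> p lt h; apply/toeplitz_ltP; exists p; rewrite ?mnmDE ?ltn_add2l //.
by move=> q /h; rewrite !mnmDE => ->.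
Qed.

End ToeplitzOrder.

Lemma mxvec_index_inj n (p q : 'I_n * 'I_n) :
  (mxvec_index p.1 p.2 == mxvec_index q.1 q.2) = (p == q).
Proof. by case: p q => [a b] [c d]; rewrite (inj_eq (@cast_ord_inj _ _ _)) (inj_eq enum_rank_inj). Qed.

Lemma mpolyX_sum (F : fieldType) N (T : Type) (s : seq T) (P : pred T)
    (E : T -> 'X_{1..N}) :
  'X_[F, (\sum_(x <- s | P x) E x)%MM] = \prod_(x <- s | P x) 'X_[E x].
Proof. exact: (big_morph _ (@mpolyXD _ _) (@mpolyX0 _ _)). Qed.

Section RookMonomials.
Variable n : nat.

Definition rook_mnm (R : {set 'I_n * 'I_n}) : 'X_{1..n * n} :=
  (\sum_(p in R) U_(mxvec_index p.1 p.2))%MM.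

Lemma rook_mnmE R p : rook_mnm R (mxvec_index p.1 p.2) = (p \in R).
Proof.
rewrite mnm_sumE; under eq_bigr do rewrite mnm1E mxvec_index_inj.
case: (boolP (p \in R)) => [pR|npR].
  by rewrite (bigD1 p) //= eqxx big1 // => q /andP[_ /negbTE->].
by apply: big1 => q qR; case: eqP => // e; rewrite -e qR in npR.
Qed.

Lemma shadow_monomialE (F : fieldType) (w : 'S_n) :
  shadow_monomial F w = 'X_[rook_mnm (shadow_set (perm_points w))].
Proof. by rewrite mpolyX_sum. Qed.

End RookMonomials.

(* Transposing a matrix preserves the relations and the dominance order
   of the positions; the flag [b] selects which of the two coordinates plays
   the role of the row, so that each argument is given only once. *)
Definition proj_row (n : nat) (b : bool) (p : 'I_n * 'I_n) : 'I_n := if b then p.2 else p.1.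

Definition flip_index (b : bool) (n : nat) (i j : 'I_n) : 'I_(n * n) :=
  if b then mxvec_index j i else mxvec_index i j.

Lemma flip_indexE b n (p : 'I_n * 'I_n) :
  flip_index b (proj_row b p) (proj_row (~~ b) p) = mxvec_index p.1 p.2.
Proof. by case: b. Qed.

Lemma flip_index_inj b n (i j i' j' : 'I_n) :
  (flip_index b i j == flip_index b i' j') = (i == i') && (j == j').
Proof.
case: b; rewrite /flip_index -/(mxvec_index (_, _).1 (_, _).2).
  by rewrite (mxvec_index_inj (j, i) (j', i')) xpair_eqE andbC.
by rewrite (mxvec_index_inj (i, j) (i', j')) xpair_eqE.
Qed.

(** Agreement is asked on the whole antidiagonal of [(i, j)], so the tie-break inside it does not
    matter and the criterion survives transposition. *)
Lemma toeplitz_lt_flip b n (m m' : 'X_{1..n * n}) (i j : 'I_n) :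
  (m (flip_index b i j) < m' (flip_index b i j))%N ->
  (forall i' j' : 'I_n, (i' + j' <= i + j)%N -> (i', j') != (i, j) ->
     m (flip_index b i' j') = m' (flip_index b i' j')) ->
  toeplitz_lt m m'.
Proof.
move=> lt h; apply/toeplitz_ltP.
case: b lt h => lt h; [exists (j, i) => //|exists (i, j) => //];
  move=> [a c] /= gt; [apply: (h c a)|apply: (h a c)];
  move: gt; rewrite /toeplitz_var_gt /= ?xpair_eqE -?val_eqE /=; lia.
Qed.

(** * Relations from the line sums *)

Section Relations.
Variables (F : fieldType) (n : nat).
Local Notation I := (@I_ideal F n).

Definition flip_var b (i j : 'I_n) : {mpoly F[n * n]} := 'X_(flip_index b i j).

Lemma I_row b i j j' : I (flip_var b i j * flip_var b i j').
Proof. by apply: ideal_gen_mem; case: b; [apply: I_gen_col|apply: I_gen_row]. Qed.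

Lemma I_col b i i' j : I (flip_var b i j * flip_var b i' j).
Proof. by apply: ideal_gen_mem; case: b; [apply: I_gen_row|apply: I_gen_col]. Qed.

Lemma I_row_sum b i : I (\sum_j flip_var b i j).
Proof. by apply: ideal_gen_mem; case: b; [apply: I_gen_col_sum|apply: I_gen_row_sum]. Qed.

Definition transversal_prod b (S : {set 'I_n}) (f : 'I_n -> 'I_n) : {mpoly F[n * n]} :=
  \prod_(i in S) flip_var b i (f i).

Lemma I_transversal b (S : {set 'I_n}) (f : 'I_n -> 'I_n) :
  ~~ dinjectiveb f S -> I (transversal_prod b S f).
Proof.
case/dinjectivePn=> i iS [i']; rewrite !inE => /andP[ni i'S] e.
rewrite /transversal_prod (bigD1 i) //= (bigD1 i') /=; last by rewrite i'S ni.
by rewrite mulrA e; apply: ideal_genMr; apply: I_col.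
Qed.

(* Modulo the row sums the rows of [S] may be summed over the complement of
   [T] instead of [T]; there are too few columns left outside [K] for an
   injective choice. *)
Lemma I_sum_transversals b (j0 : 'I_n) (S T K : {set 'I_n}) P :
  (forall i j, j \in K -> I (P * flip_var b i j)) ->
  (n < #|S| + #|T :|: K|)%N ->
  I (P * \sum_(f in pffun_on j0 (mem S) (mem T) | dinjectiveb f S) transversal_prod b S f).
Proof.
move=> IP ltn.
have Iprod : I (P * \prod_(i in S) \sum_(j in T) flip_var b i j).
  pose u i := \sum_(j in T) flip_var b i j.
  pose v i := - \sum_(j in ~: T) flip_var b i j.
  have Iuv : I (\prod_(i in S) u i - \prod_(i in S) v i).
    apply: ideal_gen_prod => i _; rewrite opprK.
    have -> : u i + \sum_(j in ~: T) flip_var b i j = \sum_j flip_var b i j.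
      rewrite (bigID (mem T) xpredT) /=; congr (_ + _); apply: eq_bigl => j.
      by rewrite inE.
    exact: I_row_sum.
  have -> : P * \prod_(i in S) u i =
      P * (\prod_(i in S) u i - \prod_(i in S) v i) + P * \prod_(i in S) v i.
    by rewrite mulrBr subrK.
  apply: ideal_genD; first exact: ideal_genM.
  rewrite prodrN mulrCA; apply: ideal_genM.
  rewrite (big_distr_big j0) /= big_distrr /=; apply: ideal_gen_sum => f ff.
  have /pffun_onP[_ fT] := ff.
  case: (boolP (dinjectiveb f S)) => [/dinjectiveP injf|/I_transversal]; last first.
    by move=> h; apply: ideal_genM; apply: h.
  have [i iS fK] : exists2 i, i \in S & f i \in K.
    apply/exists_inP; apply: contraT; rewrite negb_exists_in => /forall_inP nK.
    have sub : f @: S \subset ~: (T :|: K).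
      apply/subsetP => _ /imsetP[i iS ->]; rewrite !inE negb_or nK // andbT.
      have : f i \in ~: T by apply: fT; apply/imageP; exists i.
      by rewrite inE.
    move: (subset_leq_card sub); rewrite (card_in_imset injf) => leS.
    have := cardsC (T :|: K); rewrite card_ord => eC.
    by move: ltn; rewrite -[X in (X < _)%N]eC [X in (_ < X)%N]addnC ltn_add2l ltnNge leS.
  rewrite (bigD1 i) //= mulrA; apply: ideal_genMr; exact: IP.
move: Iprod; rewrite (big_distr_big j0) /= (bigID (fun f : {ffun 'I_n -> 'I_n} => dinjectiveb f S)) /= mulrDr.
set a := P * _; set c := P * _ => Iac.
rewrite -[a](addrK c); apply: ideal_genB => //; apply: ideal_genM.
by apply: ideal_gen_sum => f /andP[_]; apply: I_transversal.
Qed.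

End Relations.

Section LeadingTransversal.
Variables (n : nat) (b : bool) (S T : {set 'I_n}).

Definition transversal_mnm (f : 'I_n -> 'I_n) : 'X_{1..n * n} :=
  (\sum_(i in S) U_(flip_index b i (f i)))%MM.

Lemma transversal_mnmE f i j :
  transversal_mnm f (flip_index b i j) = (i \in S) && (f i == j).
Proof.
rewrite mnm_sumE; under eq_bigr do rewrite mnm1E flip_index_inj.
case: (boolP (i \in S)) => [iS|niS].
  rewrite (bigD1 i) //= eqxx big1 ?addn0 // => i' /andP[_ /negbTE-> //].
by apply: big1 => i' i'S; case: eqP => // e; rewrite -e i'S in niS.
Qed.

Lemma mdeg_transversal f : mdeg (transversal_mnm f) = #|S|.
Proof. by rewrite mdeg_sum -sum1_card; apply: eq_bigr => p _; rewrite mdeg1. Qed.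

(** [f0] is the greedy choice. In the first row [i] where [f] differs, the columns of [T] below
    [f0 i] are used up by earlier rows, so from there on both choices are at least [f0 i], and no
    other variable of these rows lies on an antidiagonal up to that of [(i, f0 i)]. *)
Lemma transversal_lt (f0 f : 'I_n -> 'I_n) :
  {in S &, forall s t : 'I_n, (s < t)%N -> (f0 s < f0 t)%N} ->
  {in T, forall j, (exists2 s, s \in S & j = f0 s) \/
                   {in S, forall s, (f0 s < j)%N}} ->
  {in S &, injective f} -> {in S, forall i, f i \in T} ->
  (exists2 i, i \in S & f i != f0 i) ->
  toeplitz_lt (transversal_mnm f) (transversal_mnm f0).
Proof.
move=> mono0 Tf0 injf fT [i1 i1S ni1].
pose differ i := (i \in S) && (f i != f0 i).
have differ1 : differ i1 by rewrite /differ i1S.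
case: (arg_minnP (P := differ) (fun i : 'I_n => val i) differ1) => i /andP[iS ni] mini.
have agree a : a \in S -> (a < i)%N -> f a = f0 a.
  move=> aS lta; apply/eqP; apply/negPn/negP => na.
  by have := mini a; rewrite /differ aS na leqNgt lta => /(_ isT).
have lower a : a \in S -> (i <= a)%N -> (f0 i <= f a)%N.
  move=> aS lea; case: (Tf0 _ (fT a aS)) => [[s sS e]|h]; last exact: ltnW (h i iS).
  rewrite e; case: (ltngtP i s) => [lt|lt|/val_inj->//]; first exact: ltnW (mono0 _ _ iS sS lt).
  (* The column [f0 s] is already taken by row [s], where [f] and [f0] agree. *)
  have ea : a = s by apply: injf; rewrite // e agree.
  by move: lt; rewrite -ea ltnNge lea.
apply: (toeplitz_lt_flip (b := b) (i := i) (j := f0 i)).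
  by rewrite !transversal_mnmE iS eqxx (negbTE ni).
move=> a c le; rewrite xpair_eqE => ne; rewrite !transversal_mnmE.
case: (boolP (a \in S)) => //= aS.
case: (ltngtP a i) => [lt|lt|/val_inj e]; first by rewrite agree.
- have l0 := lower a aS (ltnW lt); have l1 := mono0 _ _ iS aS lt.
  have /negbTE-> : f a != c by rewrite -val_eqE /=; lia.
  by have /negbTE-> : f0 a != c by rewrite -val_eqE /=; lia.
- move: ne le; rewrite e eqxx /= leq_add2l => nc le; have l0 := lower i iS (leqnn i).
  have /negbTE-> : f i != c by move: nc ni; rewrite -!val_eqE /=; lia.
  by rewrite eq_sym (negbTE nc).
Qed.

End LeadingTransversal.

Lemma card_ord_lt n c : (c <= n)%N -> (#|[set i : 'I_n | (i < c)%N]| <= c)%N.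
Proof.
move=> lec; rewrite -sum1_card (eq_bigl (fun i : 'I_n => (i < c)%N)) => [|i].
  by rewrite -(big_ord_widen n (fun=> 1%N) lec) sum1_card card_ord.
by rewrite inE.
Qed.

(** * Rewriting placements that violate the ballot condition *)

Section Reduction.
Variables (F : fieldType) (n : nat).
Local Notation I := (@I_ideal F n).
Implicit Types (m : 'X_{1..n * n}) (R C : {set 'I_n * 'I_n}).

(** Equal degrees let the rewriting terminate and keep it compatible with the grading. *)
Definition reducible m := exists q : {mpoly F[n * n]},
  [/\ I q, q@_m != 0 & forall m', m' \in msupp q -> m' != m ->
        toeplitz_lt m' m /\ mdeg m' = mdeg m].

Lemma ballot_or_violated R : ballot R \/
  exists b C c, [/\ C \subset R, chain C, (c <= n)%N,
    below (proj_row (~~ b)) C c = C &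
    (c < #|C| + #|below (proj_row (~~ b)) R c|)%N].
Proof.
pose viol b C (c : 'I_n.+1) := (below (proj_row (~~ b)) C c == C) &&
  (c < #|C| + #|below (proj_row (~~ b)) R c|)%N.
pose chainb C := [forall u in C, forall v in C, (u.1 < v.1)%N ==> (u.2 < v.2)%N].
have chainP C : reflect (chain C) (chainb C).
  apply: (iffP forall_inP) => [h u v uC vC|h u uC].
    exact: (implyP (forall_inP (h u uC) v vC)).
  by apply/forall_inP => v vC; apply/implyP; apply: h.
case: (boolP [exists C : {set 'I_n * 'I_n}, exists c : 'I_n.+1,
   [&& C \subset R, chainb C & viol true C c || viol false C c]]) => [|no].
  case/existsP=> C /existsP[c /and3P[CR /chainP chC /orP[]/andP[/eqP eC lt]]];
    right; [exists true|exists false]; by exists C, c; split=> //; rewrite -ltnS.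
left=> C c CR /chainP chC lec.
have nv b : viol b C (inord c) = false.
  apply/negbTE; apply: contra no => v; apply/existsP; exists C; apply/existsP.
  by exists (inord c); rewrite CR chC; case: b v => ->; rewrite ?orbT.
have e : (inord c : 'I_n.+1) = c :> nat by rewrite inordK.
split=> eC; rewrite leqNgt; apply/negP => lt.
  by have := nv true; rewrite /viol e; rewrite [X in X && _](introT eqP eC) lt.
by have := nv false; rewrite /viol e; rewrite [X in X && _](introT eqP eC) lt.
Qed.

Lemma chain_flip R C b : rook_placement R -> C \subset R -> chain C ->
  {in C &, forall p q, (proj_row b p < proj_row b q)%N ->
                       (proj_row (~~ b) p < proj_row (~~ b) q)%N}.
Proof.
move=> [inj1 inj2] CR chC p q pC qC; case: b => /=; last exact: chC.
rewrite /proj_row => lt2; case: (ltngtP p.1 q.1) => // [lt1|e1].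
  by have := chC _ _ qC pC lt1; lia.
have e : p = q by apply: inj1; rewrite ?(subsetP CR) //; apply: val_inj.
by move: lt2; rewrite e ltnn.
Qed.

Lemma violated_reducible R C b c :
  rook_placement R -> C \subset R -> chain C -> (c <= n)%N ->
  below (proj_row (~~ b)) C c = C ->
  (c < #|C| + #|below (proj_row (~~ b)) R c|)%N -> reducible (rook_mnm R).
Proof.
move=> rookR CR chC lec eC viol.
have injR b' : {in R &, injective (proj_row (n := n) b')}.
  by case: rookR => i1 i2; case: b'.
have injC b' : {in C &, injective (proj_row (n := n) b')}.
  by move=> p q pC qC; apply: injR; apply: (subsetP CR).
(* With [C] empty the violation would put more than [c] rooks into the first [c] lines. *)
have [p0 p0C] : exists p0, p0 \in C.
  apply/set0Pn; apply/eqP => C0; move: viol; rewrite C0 cards0 add0n ltnNge => /negP; apply.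
  rewrite -(card_in_imset (f := proj_row (~~ b))); last first.
    by move=> p q; rewrite !inE => /andP[pR _] /andP[qR _]; apply: injR.
  apply: (@leq_trans #|[set i : 'I_n | (i < c)%N]|).
    by apply/subset_leq_card/subsetP => _ /imsetP[p + ->]; rewrite !inE => /andP[].
  exact: card_ord_lt.
pose j0 := proj_row (~~ b) p0.
pose S := proj_row b @: C.
(* Each row of [C] goes to the column of its rook; the value [j0] off [S] is the default that
   [pffun_on j0] demands. *)
pose f0 i := if i \in S then
  (if [pick p in C | proj_row b p == i] is Some p then proj_row (~~ b) p else j0) else j0.
have f0E p : p \in C -> f0 (proj_row b p) = proj_row (~~ b) p.
  move=> pC; rewrite /f0 imset_f //; case: pickP => [q /andP[qC /eqP e]|/(_ p)].
    by rewrite (injC b _ _ qC pC e).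
  by rewrite pC eqxx.
pose T := proj_row (~~ b) @: C :|: [set j : 'I_n | (c <= j)%N].
pose K := proj_row (~~ b) @: (R :\: C).
pose D := rook_mnm (R :\: C).
have eR f : {in S, f =1 f0} -> (D + transversal_mnm b S f)%MM = rook_mnm R.
  move=> ef; rewrite /D /rook_mnm [RHS](bigID (mem C)) /= addmC; congr (_ + _)%MM.
    rewrite /transversal_mnm big_imset; last exact: injC.
    rewrite [RHS](eq_bigl (fun p => p \in C)) => [|p]; last first.
      by case: (boolP (p \in C)) => [/(subsetP CR)->|]; rewrite ?andbF.
    by apply: eq_bigr => p pC; rewrite ef ?imset_f // f0E // flip_indexE.
  by apply: eq_bigl => p; rewrite inE andbC.
(* The term of [f0] is the monomial of [R]; all others will be smaller. *)
pose q : {mpoly F[n * n]} := 'X_[D] *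
  \sum_(f in pffun_on j0 (mem S) (mem T) | dinjectiveb f S) transversal_prod F b S f.
have qE : q = \sum_(f in pffun_on j0 (mem S) (mem T) | dinjectiveb f S)
               'X_[(D + transversal_mnm b S f)%MM].
  rewrite /q big_distrr; apply: eq_bigr => f _ /=.
  by rewrite mpolyXD /transversal_mnm mpolyX_sum.
pose f1 : {ffun 'I_n -> 'I_n} := [ffun i => f0 i].
have f1E : {in S, f1 =1 f0} by move=> i _; rewrite ffunE.
have mono0 : {in S &, forall s t : 'I_n, (s < t)%N -> (f0 s < f0 t)%N}.
  move=> _ _ /imsetP[p pC ->] /imsetP[p' p'C ->] lt; rewrite !f0E //.
  exact: (chain_flip rookR CR chC).
have f1_on : f1 \in pffun_on j0 (mem S) (mem T).
  apply/pffun_onP; split.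
    by apply/supportP => i niS; rewrite ffunE /f0 (negbTE niS).
  move=> _ /imageP[i iS ->]; rewrite ffunE; case/imsetP: iS => p pC ->.
  by rewrite f0E // !inE imset_f.
have f1_inj : dinjectiveb f1 S.
  apply/dinjectiveP => i i' iS i'S; rewrite !ffunE => e.
  case: (ltngtP i i') => [lt|lt|/val_inj//].
    by have := mono0 _ _ iS i'S lt; rewrite e ltnn.
  by have := mono0 _ _ i'S iS lt; rewrite e ltnn.
have lower (f : {ffun 'I_n -> 'I_n}) : f \in pffun_on j0 (mem S) (mem T) ->
    dinjectiveb f S -> f != f1 ->
    toeplitz_lt (D + transversal_mnm b S f)%MM (rook_mnm R).
  move=> f_on /dinjectiveP f_inj nf; rewrite -(eR f0) //; apply: toeplitz_lt_add.
  have /pffun_onP[/supportP f_supp f_im] := f_on.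
  apply: (@transversal_lt n b S T) => //.
  - move=> j; rewrite inE => /orP[/imsetP[p pC ->]|]; [left|rewrite inE => lej; right].
      by exists (proj_row b p); rewrite ?imset_f ?f0E.
    move=> _ /imsetP[p pC ->]; rewrite f0E //.
    by move: pC; rewrite -{1}eC inE => /andP[_ lt]; apply: leq_trans lt lej.
  - by move=> i iS; apply: f_im; apply/imageP; exists i.
  - apply/exists_inP; apply: contraNT nf; rewrite negb_exists_in => /forall_inP h.
    apply/eqP/ffunP => i; rewrite ffunE; case: (boolP (i \in S)) => [iS|niS].
      by apply/eqP; rewrite -[_ == _]negbK; apply: h.
    by rewrite f_supp // /f0 (negbTE niS).
exists q; split.
- apply: (@I_sum_transversals F n b j0 S T K) => [i _ /imsetP[p pD ->]|].
    rewrite /D /rook_mnm (big_setD1 p pD) /= mpolyXD mulrAC -(flip_indexE b).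
    apply: ideal_genMr; exact: I_col.
  (* The occupied columns before [c] and all columns from [c] on: at least [n - c] more than the
     rooks before [c], so the violation gives the required count. *)
  have -> : T :|: K = proj_row (~~ b) @: below (proj_row (~~ b)) R c :|: ~: [set j : 'I_n | (j < c)%N].
    apply/setP=> j; rewrite !inE -leqNgt; case: (leqP c j) => [|lt]; rewrite ?orbT ?orbF //=.
    apply/orP/imsetP => [[]/imsetP[p pC e]|[p]].
    + by exists p => //; rewrite inE (subsetP CR) //= -e.
    + by move: pC; rewrite inE => /andP[_ pR]; exists p => //; rewrite inE pR -e.
    + rewrite inE => /andP[pR _] e; case: (boolP (p \in C)) => [pC|npC].
        by left; apply/imsetP; exists p.
      by right; apply/imsetP; exists p => //; rewrite inE npC.
  have eS : #|S| = #|C| by apply: card_in_imset; apply: injC.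
  have disj : [disjoint proj_row (~~ b) @: below (proj_row (~~ b)) R c & ~: [set j : 'I_n | (j < c)%N]].
    rewrite -setI_eq0; apply/eqP/setP=> j; rewrite !inE; apply/negP => /andP[/imsetP[p pB ->]].
    by move: pB; rewrite inE => /andP[_ ->].
  have e1 : #|proj_row (~~ b) @: below (proj_row (~~ b)) R c| = #|below (proj_row (~~ b)) R c|.
    by apply: card_in_imset => p p'; rewrite !inE => /andP[pR _] /andP[p'R _]; apply: injR.
  have e2 : (#|[set j : 'I_n | (j < c)%N]| <= c)%N.
    exact: card_ord_lt.
  have e3 := cardsC [set j : 'I_n | (j < c)%N]; rewrite card_ord in e3.
  move: (cardsUI (proj_row (~~ b) @: below (proj_row (~~ b)) R c) (~: [set j : 'I_n | (j < c)%N])).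
  move: disj; rewrite -setI_eq0 => /eqP ->; rewrite cards0 addn0 e1 eS => ->.
  rewrite addnA -[X in (X < _)%N]e3 ltn_add2r; exact: leq_ltn_trans e2 viol.
- rewrite qE raddf_sum /= (bigD1 f1) /=; last by rewrite f1_on f1_inj.
  rewrite (eR f1 f1E) mcoeffX eqxx big1 ?addr0 ?oner_neq0 // => f.
  case/andP=> /andP[f_on f_inj] nf; rewrite mcoeffX.
  case: eqP => // e; have := lower f f_on f_inj nf; by rewrite e toeplitz_ltxx.
- move=> m'; rewrite qE => /msupp_sum_le /flattenP[s /mapP[f]].
  rewrite mem_filter => /andP[/andP[f_on f_inj] _] ->; rewrite msuppX inE => /eqP-> ne.
  split; last by rewrite -(eR f0) // !mdegD !mdeg_transversal.
  apply: lower => //; apply: contraNneq ne => ->; by rewrite eR.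
Qed.

Lemma ballot_or_reducible R : rook_placement R -> ballot R \/ reducible (rook_mnm R).
Proof.
move=> rookR; case: (ballot_or_violated R) => [|[b [C [c [? ? ? ? ?]]]]]; [by left|right].
exact: (violated_reducible (C := C) (b := b) (c := c)).
Qed.

Lemma I_mnm_ge m i j : (U_(i) + U_(j) <= m)%MM -> I ('X_i * 'X_j) -> I 'X_[m].
Proof.
move=> le Iij; rewrite -(submK le) mpolyXD; apply: ideal_genM.
by rewrite mpolyXD.
Qed.

(** Any other monomial is divisible by the square of a variable or by two variables in one line. *)
Lemma mnm_rook m : I 'X_[m] \/ exists2 R, rook_placement R & m = rook_mnm R.
Proof.
pose x (p : 'I_n * 'I_n) := mxvec_index p.1 p.2.
have ge p q : p != q -> (0 < m (x p))%N -> (0 < m (x q))%N ->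
    (U_(x p) + U_(x q) <= m)%MM.
  move=> npq mp mq; apply/mnm_lepP => k; rewrite mnmDE !mnm1E.
  case: eqP => [<-|_] /=; last by case: eqP => [<-|].
  by rewrite eq_sym mxvec_index_inj (negbTE npq) addn0.
case: (boolP [forall p, (m (x p) <= 1)%N]) => [/forallP le1|]; last first.
  rewrite negb_forall => /existsP[p]; rewrite -ltnNge => lt.
  left; apply: (I_mnm_ge (i := x p) (j := x p)); last exact: (I_row F false p.1 p.2 p.2).
  by apply/mnm_lepP => k; rewrite mnmDE mnm1E; case: eqP => [<-|].
pose R := [set p | (0 < m (x p))%N].
case: (boolP [forall p in R, forall q in R, (p.1 == q.1) || (p.2 == q.2) ==> (p == q)]).
  move=> h; right; exists R.
    have h' p q : p \in R -> q \in R -> (p.1 == q.1) || (p.2 == q.2) -> p = q.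
      move=> pR qR e; apply/eqP; move: e; apply/implyP.
      exact: (forall_inP (forall_inP h p pR) q qR).
    by split=> p q pR qR e; apply: h' => //; rewrite e eqxx ?orbT.
  apply/mnmP => k; have [i j] := mxvec_indexP k.
  rewrite (rook_mnmE R (i, j)) inE; have := le1 (i, j); rewrite /x /=.
  by case: (m _) => [|[|]].
rewrite negb_forall_in => /exists_inP[p pR]; rewrite negb_forall_in => /exists_inP[q qR].
rewrite negb_imply => /andP[e npq]; left.
rewrite !inE in pR qR; apply: (I_mnm_ge (ge p q npq pR qR)).
case: p q e {pR qR npq} => [i j] [i' j'] /= /orP[]/eqP->.
  exact: (I_row F false i' j j').
exact: (I_col F false i i' j').
Qed.

End Reduction.

(** * The associated graded ideal *)

Section TopComponents.
Variables (F : fieldType) (N : nat).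
Implicit Types (f g : {mpoly F[N]}) (m : 'X_{1..N}).

Lemma msize_leP f k :
  reflect (forall m, (k <= mdeg m)%N -> f@_m = 0) (msize f <= k)%N.
Proof.
apply: (iffP idP) => [le m lem|h].
  by apply: memN_msupp_eq0; apply: msize_mdeg_ge; apply: leq_trans lem.
rewrite msizeE; apply/bigmax_leqP_seq => m mf _; rewrite ltnNge.
by apply: contraL mf => /h e; rewrite mcoeff_msupp e eqxx.
Qed.

Lemma mcoeff_pihomog d f m :
  (pihomog mdeg d f)@_m = if mdeg m == d then f@_m else 0.
Proof.
rewrite pihomogE raddf_sum /= big_mkcond /=.
have other m' : m' != m ->
    (if mdeg m' == d then (f@_m' *: 'X_[m'] : {mpoly F[N]})@_m else 0) = 0.
  by move=> ne; case: ifP => // _; rewrite mcoeffZ mcoeffX (negbTE ne) mulr0.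
case: (boolP (m \in msupp f)) => [mf|nmf].
  rewrite (bigD1_seq m) ?msupp_uniq //= big1 ?addr0 => [|m' /other//].
  by rewrite mcoeffZ mcoeffX eqxx mulr1.
rewrite big_seq big1 => [|m' m'f]; last first.
  by apply: other; apply: contraNneq nmf => <-.
by rewrite (memN_msupp_eq0 nmf) if_same.
Qed.

Lemma msize_sub_top f k : (msize f <= k.+1)%N -> (msize (f - pihomog mdeg k f) <= k)%N.
Proof.
move/msize_leP=> h; apply/msize_leP => m lem; rewrite mcoeffB mcoeff_pihomog.
case: eqVneq => [_|ne]; first by rewrite subrr.
by rewrite subr0 h // ltn_neqAle eq_sym ne.
Qed.

Lemma pihomog_small f d : (msize f <= d)%N -> pihomog mdeg d f = 0.
Proof.
move/msize_leP=> h; apply/mpolyP => m; rewrite mcoeff_pihomog mcoeff0.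
by case: eqP => // e; rewrite h ?e.
Qed.

Lemma pihomogM_homog d k f g : g \is k.-homog ->
  pihomog mdeg d (f * g) = if (k <= d)%N then pihomog mdeg (d - k) f * g else 0.
Proof.
move=> hg; rewrite {1}[f](pihomog_partitionE (mf := mdeg) (k := maxn (msize f) d.+1)) ?leq_maxl //.
rewrite mulr_suml raddf_sum /=.
have e i : pihomog mdeg d (pihomog mdeg i f * g) =
    if (i + k)%N == d then pihomog mdeg i f * g else 0.
  have h : pihomog mdeg i f * g \is (i + k).-homog by apply: dhomogM => //; apply: pihomogP.
  case: eqP => [<-|/eqP ne]; first by rewrite pihomog_dE.
  by rewrite (pihomog_ne0 ne).
case: leqP => [lekd|ltdk]; last first.
  by rewrite big1 // => i _; rewrite e; case: eqP => // ei; lia.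
have lt : (d - k < maxn (msize f) d.+1)%N by rewrite leq_max ltnS leq_subr orbT.
rewrite (bigD1 (Ordinal lt)) //= e subnK // eqxx big1 ?addr0 // => i ni.
rewrite e; case: eqP => // ei; case/eqP: ni; apply: val_inj => /=; lia.
Qed.

(** [msize _ <= d] means degree below [d]. In degree [d], a multiple [a * g] of the top component
    [g] of [f0] retains only the component of [a] of complementary degree, and that component times
    [f0] has the same part in degree [d]. *)
Lemma gr_component (I : {mpoly F[N]} -> Prop) d h :
  I 0 -> (forall f g, I f -> I g -> I (f + g)) -> (forall a f, I f -> I (a * f)) ->
  gr I h -> exists2 f, I f & (msize (pihomog mdeg d h - f) <= d)%N.
Proof.
move=> I0 ID IM [s [Gs ->]]; elim: s Gs => [|[a g] s IH] Gs.
  by exists 0; rewrite // big_nil pihomog0 subr0 msize0.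
have [f If lef] : exists2 f, I f &
    (msize (pihomog mdeg d (\sum_(p <- s) p.1 * p.2) - f)%R <= d)%N.
  by apply: IH => p ps; apply: Gs; rewrite inE ps orbT.
have [f0 [If0 nz0 /= eg]] := Gs (a, g) (mem_head _ _).
pose k := (msize f0).-1.
have ek : msize f0 = k.+1 by rewrite prednK // lt0n msize_poly_eq0.
have [f1 If1 le1] : exists2 f1, I f1 & (msize (pihomog mdeg d (a * g) - f1)%R <= d)%N.
  rewrite eg /top_component -/k (@pihomogM_homog d k); last exact: pihomogP.
  case: leqP => [lekd|_]; last by exists 0; rewrite // subr0 msize0.
  exists (pihomog mdeg (d - k) a * f0); first exact: IM.
  rewrite -mulrBr -opprB mulrN msizeN.
  have [->|nzp] := eqVneq (pihomog mdeg (d - k) a) 0; first by rewrite mul0r msize0.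
  have [->|nzq] := eqVneq (f0 - pihomog mdeg k f0) 0; first by rewrite mulr0 msize0.
  rewrite msizeM //.
  have h1 : (msize (pihomog mdeg (d - k) a) <= (d - k).+1)%N.
    apply/msize_leP => m lem; rewrite mcoeff_pihomog; case: eqP => // e.
    by move: lem; rewrite e ltnn.
  have h2 := msize_sub_top (eq_leq ek).
  by move: h1 h2; set A := msize _; set B := msize _; lia.
exists (f1 + f); first exact: ID.
rewrite big_cons /= pihomogD opprD addrACA.
by apply: leq_trans (msizeD_le _ _) _; rewrite geq_max le1 lef.
Qed.

(** Unless [g] is zero, [f] has degree exactly [d] and [g] is its top component. *)
Lemma gr_mem (I : {mpoly F[N]} -> Prop) d f g :
  I f -> g \is d.-homog -> (msize (f - g) <= d)%N -> gr I g.
Proof.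
move=> If hg lefg; have [->|nz] := eqVneq g 0; first exact: ideal_gen0.
have eg : pihomog mdeg d f = g.
  by rewrite -[f](subrK g) pihomogD (pihomog_small lefg) add0r pihomog_dE.
have lef : (msize f <= d.+1)%N.
  apply/msize_leP => m lem; rewrite -[f](subrK g) mcoeffD.
  rewrite (msize_leP _ _ lefg) ?(ltnW lem) // add0r (dhomog_nemf_coeff hg) //.
  by move: lem; rewrite ltn_neqAle eq_sym => /andP[].
have ef : msize f = d.+1.
  apply/eqP; rewrite eqn_leq lef ltnNge; apply: contra nz => le.
  by rewrite -eg pihomog_small.
apply: ideal_gen_mem; exists f; split=> //; last by rewrite /top_component ef.
by rewrite -msize_poly_eq0 ef.
Qed.

End TopComponents.

(** * Spanning by shadow monomials *)

Section Spanning.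
Variables (F : fieldType) (n : nat).
Local Notation I := (@I_ideal F n).
Local Notation s := (@shadow_monomial n F).
Local Notation A := {mpoly F[n * n]}.

Definition shadow_mnm (w : 'S_n) : 'X_{1..n * n} :=
  rook_mnm (shadow_set (perm_points w)).

Lemma shadow_monomialX w : s w = 'X_[shadow_mnm w].
Proof. exact: shadow_monomialE. Qed.

(** [Q] records bounds on order or degree that a reduction respects; [J] is the defining ideal or
    the vanishing ideal. *)
Definition shadow_span (J : A -> Prop) (Q : 'S_n -> Prop) (f : A) :=
  exists2 c : 'S_n -> F, J (f - \sum_w c w *: s w) & forall w, c w != 0 -> Q w.

Section SpanClosure.
Variable J : A -> Prop.
Hypotheses (J0 : J 0) (JD : forall f g, J f -> J g -> J (f + g))
  (JM : forall a f, J f -> J (a * f)).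

Lemma shadow_span_mem Q f : J f -> shadow_span J Q f.
Proof.
exists (fun=> 0) => [|w]; last by rewrite eqxx.
by rewrite big1 ?subr0 // => w _; rewrite scale0r.
Qed.

Lemma shadow_spanD Q f g : shadow_span J Q f -> shadow_span J Q g -> shadow_span J Q (f + g).
Proof.
move=> [c Jc Qc] [d Jd Qd]; exists (fun w => c w + d w).
  have -> : \sum_w (c w + d w) *: s w = \sum_w c w *: s w + \sum_w d w *: s w.
    by rewrite -big_split; apply: eq_bigr => w _; rewrite scalerDl.
  by rewrite opprD addrACA; apply: JD.
by move=> w; case: (eqVneq (c w) 0) => [->|/Qc//]; rewrite add0r; apply: Qd.
Qed.

Lemma shadow_spanZ Q a f : shadow_span J Q f -> shadow_span J Q (a *: f).
Proof.
move=> [c Jc Qc]; exists (fun w => a * c w).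
  have -> : \sum_w (a * c w) *: s w = a *: \sum_w c w *: s w.
    by rewrite scaler_sumr; apply: eq_bigr => w _; rewrite scalerA.
  by rewrite -scalerBr -mul_mpolyC; apply: JM.
by move=> w; rewrite mulf_eq0 negb_or => /andP[_ /Qc].
Qed.

Lemma shadow_span_sum Q (T : eqType) (r : seq T) (P : pred T) (E : T -> A) :
  (forall x, x \in r -> P x -> shadow_span J Q (E x)) ->
  shadow_span J Q (\sum_(x <- r | P x) E x).
Proof.
move=> h; rewrite big_seq_cond; apply: big_ind => [| |x /andP[xr Px]].
- exact: shadow_span_mem.
- exact: shadow_spanD.
- exact: h.
Qed.

Lemma shadow_span_shadow (Q : 'S_n -> Prop) w : Q w -> shadow_span J Q (s w).
Proof.
move=> Qw; exists (fun v => (v == w)%:R) => [|v].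
  rewrite (bigD1 w) //= eqxx scale1r big1 ?addr0 ?subrr // => v /negbTE->.
  by rewrite scale0r.
by case: (eqVneq v w) => [->|_] //; rewrite eqxx.
Qed.

Lemma shadow_span_sub (Q Q' : 'S_n -> Prop) f :
  (forall w, Q w -> Q' w) -> shadow_span J Q f -> shadow_span J Q' f.
Proof. by move=> sub [c Jc Qc]; exists c => // w /Qc /sub. Qed.

End SpanClosure.

Let I0 : I 0 := ideal_gen0 _.
Let ID : forall f g, I f -> I g -> I (f + g) := @ideal_genD _ _.
Let IM : forall a f, I f -> I (a * f) := @ideal_genM _ _.

Definition dominated m (w : 'S_n) :=
  mdeg (shadow_mnm w) = mdeg m /\
  (shadow_mnm w = m \/ toeplitz_lt (shadow_mnm w) m).

Local Notation N := (n * n)%N.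

(** The termination measure: a fixed degree has only finitely many monomials. *)
Lemma card_lower_lt m m' : toeplitz_lt m' m -> mdeg m' = mdeg m ->
  (#|[set t : 'X_{1..N < (mdeg m').+1} | toeplitz_lt (bmnm t) m' && (mdeg t == mdeg m')]| <
   #|[set t : 'X_{1..N < (mdeg m).+1} | toeplitz_lt (bmnm t) m && (mdeg t == mdeg m)]|)%N.
Proof.
move=> lt ed; rewrite ed; apply/proper_card/properP; split.
  apply/subsetP => t; rewrite !inE => /andP[lt' ->]; rewrite andbT.
  exact: toeplitz_lt_trans lt' lt.
have ltd : (mdeg m' < (mdeg m).+1)%N by rewrite ed.
by exists (BMultinom ltd); rewrite !inE /= ?toeplitz_ltxx // lt ed eqxx.
Qed.

Lemma dominated_trans m m' w :
  toeplitz_lt m' m -> mdeg m' = mdeg m -> dominated m' w -> dominated m w.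
Proof.
move=> lt ed [ed' h]; split; first by rewrite ed'.
by right; case: h => [->//|h]; apply: toeplitz_lt_trans h lt.
Qed.

Lemma shadow_span_mnm m : shadow_span I (dominated m) 'X_[m].
Proof.
have [k] := ubnP #|[set t : 'X_{1..N < (mdeg m).+1} |
                     toeplitz_lt (bmnm t) m && (mdeg t == mdeg m)]|.
elim: k m => // k IH m ltk.
case: (mnm_rook F m) => [Im|[R rookR em]]; first exact: shadow_span_mem.
case: (ballot_or_reducible F rookR) => [ballotR|].
  have [w ew] := ballot_shadow rookR ballotR.
  have eX : s w = 'X_[m] by rewrite shadow_monomialX em /shadow_mnm ew.
  rewrite -eX; apply: shadow_span_shadow => //.
  by rewrite /dominated /shadow_mnm ew -em; split=> //; left.
rewrite -em => -[q [Iq nzq lowq]].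
have mq : m \in msupp q by rewrite mcoeff_msupp.
(* The relation [q] is solved for its leading monomial. *)
have -> : 'X_[m] = (q@_m)^-1 *: (q + (-1) *: \sum_(m' <- msupp q | m' != m) q@_m' *: 'X_[m']).
  rewrite {2}[q]mpolyE (bigD1_seq m) ?msupp_uniq //= scaleN1r addrK scalerA.
  by rewrite mulVf // scale1r.
apply: shadow_spanZ => //; apply: shadow_spanD => //; first exact: shadow_span_mem.
apply: shadow_spanZ => //; apply: shadow_span_sum => // m' m'q ne.
apply: shadow_spanZ => //; have [lt ed] := lowq m' m'q ne.
apply: shadow_span_sub (IH m' _) => [w|]; first exact: dominated_trans.
exact: leq_trans (card_lower_lt lt ed) ltk.
Qed.

(** * Independence by evaluation at permutation matrices *)

Section Independence.
Local Notation V := (vanishing_ideal (@perm_matrix_locus F n)).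

Lemma vanishingD f g : V f -> V g -> V (f + g).
Proof. by move=> Vf Vg z Zz; rewrite mevalD Vf // Vg // addr0. Qed.

Lemma vanishingM a f : V f -> V (a * f).
Proof. by move=> Vf z Zz; rewrite mevalM Vf // mulr0. Qed.

Lemma vanishing0 : V 0.
Proof. by move=> z _; rewrite meval0. Qed.

Definition perm_eval (sigma : 'S_n) (f : A) : F :=
  f.@[fun k => mxvec (perm_mx sigma) 0 k].

Lemma vanishingP f : V f <-> forall sigma, perm_eval sigma f = 0.
Proof.
split=> [Vf sigma|h z [B /is_perm_mxP[sigma ->] ->]]; last exact: h.
by apply: Vf; exists (perm_mx sigma) => //; apply/is_perm_mxP; exists sigma.
Qed.

Lemma perm_eval_xvar sigma i j : perm_eval sigma (xvar F i j) = (sigma i == j)%:R.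
Proof. by rewrite /perm_eval mevalXU mxvecE !mxE. Qed.

Lemma perm_eval_sum sigma (c : 'S_n -> F) :
  perm_eval sigma (\sum_w c w *: s w) = \sum_w c w * perm_eval sigma (s w).
Proof.
rewrite /perm_eval (big_morph _ (mevalD _) (meval0 _)).
by apply: eq_bigr => w _; rewrite mevalZ.
Qed.

(** On permutation matrices entries are idempotent, two entries of one line multiply to zero and
    line sums are one; each generator is thus corrected by terms of lower degree to a vanishing
    polynomial. *)
Lemma I_sub_gr f : I f -> gr V f.
Proof.
apply: ideal_gen_sub => _ [i j j'|i i' j|i|j].
- apply: (@gr_mem _ _ _ 2 (xvar F i j * xvar F i j' - (j == j')%:R *: xvar F i j)).
  + apply/vanishingP => sigma; rewrite /perm_eval mevalB mevalM mevalZ.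
    rewrite -!/(perm_eval sigma _) !perm_eval_xvar.
    case: (eqVneq (sigma i) j) => [->|_]; last by rewrite mul0r mulr0 subr0.
    by rewrite mul1r mulr1 subrr.
  + by rewrite /xvar -mpolyXD dhomogX /= mdegD !mdeg1.
  + rewrite addrAC subrr add0r msizeN; apply: leq_trans (msizeZ_le _ _) _.
    by rewrite msizeX mdeg1.
- apply: (@gr_mem _ _ _ 2 (xvar F i j * xvar F i' j - (i == i')%:R *: xvar F i j)).
  + apply/vanishingP => sigma; rewrite /perm_eval mevalB mevalM mevalZ.
    rewrite -!/(perm_eval sigma _) !perm_eval_xvar.
    case: (eqVneq (sigma i) j) => [<-|_]; last by rewrite mul0r mulr0 subr0.
    by rewrite mul1r mulr1 (inj_eq perm_inj) eq_sym subrr.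
  + by rewrite /xvar -mpolyXD dhomogX /= mdegD !mdeg1.
  + rewrite addrAC subrr add0r msizeN; apply: leq_trans (msizeZ_le _ _) _.
    by rewrite msizeX mdeg1.
- apply: (@gr_mem _ _ _ 1 (\sum_j xvar F i j - 1)).
  + apply/vanishingP => sigma; rewrite /perm_eval mevalB meval1 raddf_sum /=.
    under eq_bigr do rewrite -/(perm_eval sigma _) perm_eval_xvar.
    rewrite (bigD1 (sigma i)) //= eqxx big1 ?addr0 ?subrr // => j.
    by rewrite eq_sym => /negbTE->.
  + by apply: rpred_sum => j _; rewrite dhomogX /= mdeg1.
  + by rewrite addrAC subrr add0r msizeN msize1.
- apply: (@gr_mem _ _ _ 1 (\sum_i xvar F i j - 1)).
  + apply/vanishingP => sigma; rewrite /perm_eval mevalB meval1 raddf_sum /=.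
    under eq_bigr do rewrite -/(perm_eval sigma _) perm_eval_xvar.
    rewrite (bigD1 ((sigma^-1)%g j)) //= permKV eqxx big1 ?addr0 ?subrr // => i ne.
    by case: eqP => // e; rewrite -e permK eqxx in ne.
  + by apply: rpred_sum => i _; rewrite dhomogX /= mdeg1.
  + by rewrite addrAC subrr add0r msizeN msize1.
Qed.

Lemma homog_shadow_sum d (c : 'S_n -> F) :
  pihomog mdeg d (\sum_w c w *: s w) = \sum_(w | mdeg (shadow_mnm w) == d) c w *: s w.
Proof.
rewrite raddf_sum /= [RHS]big_mkcond /=; apply: eq_bigr => w _.
by rewrite linearZ /= shadow_monomialX pihomogX; case: ifP => // _; rewrite scaler0.
Qed.

(** Modulo the vanishing ideal, a relation of its graded ideal holds up to lower degree, which the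
    induction absorbs. The degree bound is what allows comparing top components in
    [shadow_gr_free]. *)
Lemma shadow_span_eval k f : (msize f <= k)%N ->
  shadow_span V (fun w => (mdeg (shadow_mnm w) < k)%N) f.
Proof.
have V0 := vanishing0; have VD := vanishingD; have VM := vanishingM.
elim: k f => [|k IH] f lef.
  have -> : f = 0 by apply/eqP; rewrite -msize_poly_eq0 -leqn0.
  exact: shadow_span_mem.
rewrite [f]mpolyE; apply: shadow_span_sum => // m mf _; apply: shadow_spanZ => //.
have ltm : (mdeg m < k.+1)%N by apply: leq_trans lef; apply: msize_mdeg_lt.
have [c Ic dc] := shadow_span_mnm m.
have [g Vg leg] := gr_component (mdeg m) V0 VD VM (I_sub_gr Ic).
(* Reduction preserves degree, so the difference is homogeneous and [gr_component] applies to all of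
   it. *)
have hom : pihomog mdeg (mdeg m) ('X_[m] - \sum_w c w *: s w) = 'X_[m] - \sum_w c w *: s w.
  rewrite pihomogB pihomogX eqxx homog_shadow_sum; congr (_ - _).
  rewrite big_mkcond; apply: eq_bigr => w _; case: eqP => // ne.
  by case: (eqVneq (c w) 0) => [->|/dc[]//]; rewrite scale0r.
rewrite hom in leg.
have -> : 'X_[m] = (('X_[m] - \sum_w c w *: s w) - g) + (g + \sum_w c w *: s w).
  by rewrite addrA subrK subrK.
apply: shadow_spanD => //.
  apply: shadow_span_sub (IH _ (leq_trans leg ltm)) => w; exact: ltnW.
apply: shadow_spanD => //; first exact: shadow_span_mem.
apply: shadow_span_sum => // w _ _.
have [->|nz] := eqVneq (c w) 0; first by rewrite scale0r; apply: shadow_span_mem.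
by apply: shadow_spanZ => //; apply: shadow_span_shadow => //; have [-> _] := dc w nz.
Qed.

(* The [n!] shadow monomials span the functions on the [n!] permutation
   matrices, hence are linearly independent there. *)
Lemma shadow_eval_free (c : 'S_n -> F) :
  V (\sum_w c w *: s w) -> forall w, c w = 0.
Proof.
pose E : 'M[F]_#|'S_n| := \matrix_(a, b) perm_eval (enum_val b) (s (enum_val a)).
have full : row_full E.
  rewrite -sub1mx; apply/row_subP => a; pose sigma0 : 'S_n := enum_val a.
  (* This monomial is the indicator of [sigma0] on permutation matrices; its expansion puts a row of
     the identity into the row space of [E]. *)
  pose delta : A := \prod_i xvar F i (sigma0 i).
  have [u Vu _] := shadow_span_eval (leqnn (msize delta)).
  apply/submxP; exists (\row_b u (enum_val b)); apply/rowP => b; rewrite !mxE.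
  have /vanishingP/(_ (enum_val b)) := Vu.
  rewrite /perm_eval mevalB -!/(perm_eval _ _) perm_eval_sum => /eqP.
  rewrite subr_eq0 => /eqP e.
  transitivity (perm_eval (enum_val b) delta).
    rewrite /perm_eval rmorph_prod /=.
    under eq_bigr do rewrite -/(perm_eval _ _) perm_eval_xvar.
    case: (eqVneq a b) => [<-|ne]; first by rewrite big1 // => i _; rewrite eqxx.
    have /existsP[i ni] : [exists i, enum_val b i != sigma0 i].
      rewrite -negb_forall; apply: contraNN ne => /forallP h; apply/eqP.
      by apply: enum_val_inj; apply/permP => i; rewrite (eqP (h i)).
    by rewrite (bigD1 i) //= (negbTE ni) mul0r.
  rewrite e (reindex (enum_val (A := 'S_n))) /=; last first.
    by exists enum_rank => x _; rewrite ?enum_valK ?enum_rankK.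
  by apply: eq_bigr => a' _; rewrite !mxE.
have Eu : E \in unitmx by rewrite -row_full_unit.
move=> Vc w; pose u : 'rV_#|'S_n| := \row_b c (enum_val b).
have uE : u *m E = 0.
  apply/rowP => b; rewrite !mxE; have /vanishingP/(_ (enum_val b)) := Vc.
  rewrite perm_eval_sum (reindex (enum_val (A := 'S_n))) /=; last first.
    by exists enum_rank => x _; rewrite ?enum_valK ?enum_rankK.
  by move=> e0; rewrite -[RHS]e0; apply: eq_bigr => a' _; rewrite !mxE.
have u0 : u = 0 by rewrite -[u](mulmxK Eu) uE mul0mx.
by have := congr1 (fun v : 'rV_#|'S_n| => v 0 (enum_rank w)) u0; rewrite !mxE enum_rankK.
Qed.

(** The part in the degree of [s w] agrees with a vanishing polynomial up to lower degree, and that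
    remainder expands in shadow monomials of lower degree. The resulting relation on matrices still
    has [c w] as coefficient of [s w]. *)
Lemma shadow_gr_free (c : 'S_n -> F) :
  gr V (\sum_w c w *: s w) -> forall w, c w = 0.
Proof.
move=> gc w; pose d := mdeg (shadow_mnm w).
have [f Vf] := gr_component d vanishing0 vanishingD vanishingM gc.
rewrite homog_shadow_sum => /shadow_span_eval[u Vu ltu].
have h : V (\sum_v ((if mdeg (shadow_mnm v) == d then c v else 0) - u v) *: s v).
  have -> : \sum_v ((if mdeg (shadow_mnm v) == d then c v else 0) - u v) *: s v =
      ((\sum_(v | mdeg (shadow_mnm v) == d) c v *: s v - f) - \sum_v u v *: s v) + f.
    rewrite addrAC subrK [X in _ = X - _]big_mkcond -sumrB; apply: eq_bigr => v _.
    by rewrite scalerBl; case: ifP => // _; rewrite scale0r.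
  exact: vanishingD.
have := shadow_eval_free h w; rewrite eqxx.
by case: (eqVneq (u w) 0) => [->|/ltu]; rewrite ?subr0 // ltnn.
Qed.

Lemma shadow_span_all f : shadow_span I (fun=> True) f.
Proof.
rewrite [f]mpolyE; apply: shadow_span_sum => // m _ _; apply: shadow_spanZ => //.
exact: shadow_span_sub (shadow_span_mnm m).
Qed.

(** The normal form of [f] modulo the smaller ideal lies in the graded ideal, hence is zero by
    independence. *)
Lemma gr_sub_I f : gr V f -> I f.
Proof.
move=> gf; have [c Ic _] := shadow_span_all f.
have c0 w : c w = 0.
  apply: shadow_gr_free w.
  have -> : \sum_w c w *: s w = f - (f - \sum_w c w *: s w) by rewrite subKr.
  by apply: ideal_genB => //; apply: I_sub_gr.
by move: Ic; rewrite big1 ?subr0 // => w _; rewrite c0 scale0r.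
Qed.

Lemma shadow_free (c : 'S_n -> F) : I (\sum_w c w *: s w) -> forall w, c w = 0.
Proof. by move=> /I_sub_gr; apply: shadow_gr_free. Qed.

(** Independence is indexed by permutations: two equal shadow monomials would give the nontrivial
    relation that their difference is zero. *)
Lemma shadow_monomial_inj : injective s.
Proof.
move=> w v e; apply/eqP; apply/negPn/negP => ne.
have h : I (\sum_u ((u == w)%:R - (u == v)%:R) *: s u).
  rewrite (bigD1 w) //= (bigD1 v) /=; last by rewrite eq_sym.
  rewrite !eqxx (negbTE ne) eq_sym (negbTE ne) big1 => [|u /andP[/negbTE-> /negbTE->]].
    by rewrite subr0 sub0r scale1r scaleN1r addr0 e subrr; apply: ideal_gen0.
  by rewrite subrr scale0r.
have := shadow_free h w; rewrite eqxx (negbTE ne) subr0 => /eqP.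
by rewrite oner_eq0.
Qed.

End Independence.
End Spanning.

(** * The basis and the standard monomials *)

Lemma shadow_basis (F : fieldType) n :
  descends_to_basis (@I_ideal F n) (fun g => exists w : 'S_n, g = shadow_monomial F w).
Proof.
split=> [f|t c uniq_t tB It g gt].
  have [c Ic _] := shadow_span_all f.
  exists [seq (c w, shadow_monomial F w) | w <- enum 'S_n]; split.
    by move=> _ /mapP[w _ ->]; exists w.
  by rewrite big_map big_enum.
(* Coefficients are carried from polynomials to permutations, with zero off the list; injectivity of
   the shadow monomials prevents double counting. *)
pose d (w : 'S_n) := if shadow_monomial F w \in t then c (shadow_monomial F w) else 0.
have e : \sum_(h <- t) c h *: h = \sum_w d w *: shadow_monomial F w.
  have inj := @shadow_monomial_inj F n.
  have pe : perm_eq t [seq shadow_monomial F w | w <- enum 'S_n & shadow_monomial F w \in t].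
    apply: uniq_perm => //; first by rewrite (map_inj_uniq inj) filter_uniq // enum_uniq.
    move=> h; apply/idP/mapP => [ht|[w + ->]]; last by rewrite mem_filter => /andP[].
    by have [w ew] := tB h ht; exists w; rewrite // mem_filter mem_enum -ew ht.
  rewrite (perm_big _ pe) big_map big_filter big_enum_cond big_mkcond /=.
  by apply: eq_bigr => w _; rewrite /d; case: ifP => // _; rewrite scale0r.
rewrite e in It; have [w ew] := tB g gt.
by have := shadow_free It w; rewrite /d -ew gt.
Qed.

(** If [f] had this leading monomial, its other terms would reduce to strictly smaller shadow
    monomials, leaving a relation whose coefficient at [w] is the leading one. *)
Lemma shadow_standard (F : fieldType) n (w : 'S_n) :
  standard_monomial (@toeplitz_lt n) (@I_ideal F n) (shadow_mnm w).
Proof.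
move=> [f [If _ [wf low]]].
have I0 := ideal_gen0 (@I_gen F n).
have ID := @ideal_genD _ (@I_gen F n); have IM := @ideal_genM _ (@I_gen F n).
have : shadow_span (@I_ideal F n) (fun v => toeplitz_lt (shadow_mnm v) (shadow_mnm w))
    (\sum_(m <- msupp f | m != shadow_mnm w) f@_m *: 'X_[m]).
  apply: shadow_span_sum => // m mf ne; apply: shadow_spanZ => //.
  apply: shadow_span_sub (shadow_span_mnm F m) => v [_ [->|lt]]; first exact: low.
  exact: toeplitz_lt_trans lt (low m mf ne).
case=> c Ic lowc.
have cw : c w = 0.
  by apply/eqP; apply: contraT => /lowc; rewrite toeplitz_ltxx.
have h : @I_ideal F n (\sum_v (c v + (v == w)%:R * f@_(shadow_mnm w)) *: shadow_monomial F v).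
  have -> : \sum_v (c v + (v == w)%:R * f@_(shadow_mnm w)) *: shadow_monomial F v =
      f - (\sum_(m <- msupp f | m != shadow_mnm w) f@_m *: 'X_[m] -
           \sum_v c v *: shadow_monomial F v).
    transitivity (\sum_v c v *: shadow_monomial F v + f@_(shadow_mnm w) *: shadow_monomial F w).
      under eq_bigr do rewrite scalerDl; rewrite big_split /=; congr (_ + _).
      rewrite (bigD1 w) //= eqxx mul1r big1 ?addr0 // => v /negbTE->.
      by rewrite mul0r scale0r.
    rewrite {2}[f]mpolyE (bigD1_seq (shadow_mnm w)) ?msupp_uniq //= -shadow_monomialX.
    by rewrite opprB addrACA subrr addr0 addrC.
  exact: ideal_genB.
have := shadow_free h w; rewrite cw eqxx mul1r add0r => /eqP.
by rewrite mcoeff_eq0 wf.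
Qed.

Theorem theorem3p12 (F : fieldType) (n : nat) (hn : (1 <= n)%N) :
  (forall f : {mpoly F[n * n]},
     I_ideal f <-> gr (vanishing_ideal (@perm_matrix_locus F n)) f) /\
  descends_to_basis (@I_ideal F n)
    (fun g => exists w : 'S_n, g = shadow_monomial F w) /\
  (forall g : {mpoly F[n * n]},
     (exists w : 'S_n, g = shadow_monomial F w) <->
     (exists2 m : 'X_{1..n * n},
        standard_monomial (@toeplitz_lt n) (@I_ideal F n) m & g = 'X_[m])).
Proof.
split; first by move=> f; split; [apply: I_sub_gr | apply: gr_sub_I].
split; first exact: shadow_basis.
move=> g; split=> [[w ->]|[m std ->]].
  exists (shadow_mnm w); [exact: shadow_standard | exact: shadow_monomialX].
(* A standard monomial is neither in the ideal nor reducible, so it comes from a placement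
   satisfying the ballot condition. *)
case: (mnm_rook F m) => [Im|[R rookR em]].
  case: std; exists 'X_[m]; split=> //; first by rewrite -msize_poly_eq0 msizeX.
  by split=> [|m']; rewrite msuppX inE // => /eqP->; rewrite eqxx.
case: (ballot_or_reducible F rookR) => [ballotR|].
  have [w ew] := ballot_shadow rookR ballotR.
  by exists w; rewrite shadow_monomialX em /shadow_mnm ew.
rewrite -em => -[q [Iq nzq lowq]]; case: std; exists q; split=> //.
  by apply: contraNneq nzq => ->; rewrite mcoeff0.
split=> [|m' m'q ne]; first by rewrite mcoeff_msupp.
by have [] := lowq m' m'q ne.
Qed.
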